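(* Let $n\ge 1$. The assignment $\mathfrak{u}_i\mapsto \underline{U}_i$ ($0\le i\le n-1$) extends to a monoid isomorphism from the diagrammatic blob monoid $\mathfrak{Bl}_n$ onto the hook blob monoid $\mathfrak{H}_n$.
   Context: TL-diagrams and blobbed TL-diagrams: place top points $1,\dots,n$ at $(1,1),\dots,(n,1)$ and bottom points $1',\dots,n'$ at $(1,0),\dots,(n,0)$ in the strip $\mathbb{R}\times[0,1]$; a TL-diagram is a set of $n$ pairwise disjoint arcs in the strip pairing these $2n$ points, up to isotopy (a non-crossing perfect matching). The left side is the unbounded region of the complement of the arcs containing points $(x,1/2)$ with $x$ very negative; an arc is exposed to the left side if it lies on the boundary of that region. A blobbed TL-diagram is a TL-diagram in which some left-exposed arcs carry one blob each. $\mathfrak{Bl}_n$ is the set of blobbed TL-diagrams on $n$ points with product $D\cdot D'$: place $D$ above $D'$, identify the bottom of $D$ with the top of $D'$, delete closed loops, and give each resulting arc exactly one blob if some constituent piece carried a blob, none otherwise. $\mathfrak{u}_0$ is the identity diagram with a blob on the arc $\{1,1'\}$; for $1\le i\le n-1$, $\mathfrak{u}_i$ is the unblobbed diagram with arcs $\{i,i+1\}$, $\{i',(i+1)'\}$, $\{k,k'\}$ ($k\ne i,i+1$). Let $\underline{\mathfrak{C}}_n$ be the partition monoid of the set $\{0,1,\dots,n\}\cup\{0',1',\dots,n'\}$ (product: stack the first partition above the second, identifying its primed points with the unprimed points of the second, take connected components, keep their nonempty intersections with the outer rows). Define $\underline{U}_0$ with blocks $\{0,1,0',1'\}$ and $\{k,k'\}$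 for $2\le k\le n$; for $1\le i\le n-1$, $\underline{U}_i$ with blocks $\{0,0'\}$, $\{i,i+1\}$, $\{i',(i+1)'\}$ and $\{k,k'\}$ for $k\in[1,n]\setminus\{i,i+1\}$. The hook blob monoid $\mathfrak{H}_n$ is the submonoid of $\underline{\mathfrak{C}}_n$ generated by $\underline{U}_0,\dots,\underline{U}_{n-1}$. *)

(* Defs.v *)
From HB Require Import structures.
From mathcomp Require Import all_boot.
From mathcomp Require Import zify.

Set Implicit Arguments.
Unset Strict Implicit.
Unset Printing Implicit Defensive.


Record setpart (T : finType) :=
  SetPart { blocks :> {set {set T}}; _ : partition blocks [set: T] }.

HB.instance Definition _ (T : finType) := [isSub for @blocks T].
HB.instance Definition _ (T : finType) := [Finite of setpart T by <:].

Section SetPartTheory.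
Variable T : finType.
Implicit Types (P Q : setpart T) (x y z : T).

Definition same P x y := y \in pblock P x.

Lemma setpartP P : partition P [set: T]. Proof. by case: P. Qed.

Lemma setpart_cover P x : x \in cover P.
Proof. by have /and3P[/eqP-> _ _] := setpartP P; rewrite inE. Qed.

Lemma setpart_triv P : trivIset P.
Proof. by have /and3P[] := setpartP P. Qed.

Lemma same_refl P x : same P x x.
Proof. by rewrite /same mem_pblock setpart_cover. Qed.

Lemma same_equiv P : equivalence_rel (same P).
Proof.
move=> x y z; exact: (pblock_equivalence (setpartP P) (in_setT x) (in_setT y)).
Qed.

Lemma same_sym P x y : same P x y = same P y x.
Proof.
have [_ e] := same_equiv P x y x; have [_ e'] := same_equiv P y x y.
by apply/idP/idP => h; [rewrite -(e h) same_refl | rewrite -(e' h) same_refl].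
Qed.

Lemma same_trans P y x z : same P x y -> same P y z -> same P x z.
Proof. by move=> h; have [_ ->] := same_equiv P x y z. Qed.

Lemma sameE P x y : [exists B in P, (x \in B) && (y \in B)] = same P x y.
Proof.
apply/existsP/idP => [[B /and3P[BP xB yB]]|xy].
  by rewrite /same (def_pblock (setpart_triv P) BP xB).
exists (pblock P x); rewrite pblock_mem ?setpart_cover //.
by rewrite mem_pblock setpart_cover.
Qed.

Lemma same_block P B x y : B \in P -> x \in B -> (y \in B) = same P x y.
Proof. by move=> BP xB; rewrite /same (def_pblock (setpart_triv P) BP xB). Qed.

Lemma setpart_ext P Q : same P =2 same Q -> P = Q.
Proof.
move=> e; apply: val_inj => /=.
rewrite -(equivalence_partition_pblock (setpartP P)).
rewrite -(equivalence_partition_pblock (setpartP Q)).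
by apply: eq_in_imset => x _; apply/setP => y; rewrite !inE; apply: e.
Qed.

Lemma block_nonempty P B : B \in P -> exists x, x \in B.
Proof.
move=> BP; apply/set0Pn; apply/eqP => B0.
by have /and3P[_ _] := setpartP P; rewrite -B0 BP.
Qed.

End SetPartTheory.

Lemma connect_ind (T : finType) (e : rel T) (I : T -> Prop) x :
  I x -> (forall u v, I u -> e u v -> I v) -> forall y, connect e x y -> I y.
Proof.
move=> Ix Ie y /connectP[p]; elim: p x Ix => [|z p IHp] x Ix /=; first by move=> _ ->.
by case/andP=> /(Ie _ _ Ix)/IHp h /h.
Qed.

(* Stacking: elements of X + X are the unprimed (inl) and primed (inr) points.
   The points of a stack of two such diagrams form X + X + X, whose summands
   are the top row, the shared middle row and the bottom row.                 *)

Section Stack.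
Variable X : finType.
Implicit Types (P Q R : setpart (X + X)%type) (b c d : pred (X + X)).

Definition upper (p : X + X) : X + X + X := inl p.

Definition lower (p : X + X) : X + X + X :=
  match p with inl m => inl (inr m) | inr b => inr b end.

Definition outer (p : X + X) : X + X + X :=
  match p with inl t => inl (inl t) | inr b => inr b end.

Definition stack_edge (P Q : {set {set (X + X)}}) : rel (X + X + X) :=
  fun u v =>
    [exists B in P, (u \in upper @: B) && (v \in upper @: B)]
    || [exists B in Q, (u \in lower @: B) && (v \in lower @: B)].

Definition stack_connect (P Q : {set {set (X + X)}}) : rel (X + X + X) :=
  connect (stack_edge P Q).

Definition stack_outer (P Q : {set {set (X + X)}}) : {set {set (X + X)}} :=
  equivalence_partition
    (fun x y => stack_connect P Q (outer x) (outer y)) [set: (X + X)%type].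

Lemma upper_inj : injective upper. Proof. by move=> x y []. Qed.
Lemma lower_inj : injective lower. Proof. by move=> [x|x] [y|y] // [->]. Qed.
Lemma outer_inj : injective outer. Proof. by move=> [x|x] [y|y] // [->]. Qed.

Lemma stack_edgeP P Q u v :
  reflect ((exists p q, [/\ u = upper p, v = upper q & same P p q])
           \/ (exists p q, [/\ u = lower p, v = lower q & same Q p q]))
          (stack_edge P Q u v).
Proof.
apply: (iffP orP) => [[]|[]].
- case/existsP=> B /and3P[BP /imsetP[p pB ->] /imsetP[q qB ->]].
  by left; exists p, q; rewrite -(same_block q BP pB).
- case/existsP=> B /and3P[BP /imsetP[p pB ->] /imsetP[q qB ->]].
  by right; exists p, q; rewrite -(same_block q BP pB).
- case=> p [q [-> -> ]]; rewrite -sameE => /existsP[B /and3P[BP pB qB]]; left.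
  by apply/existsP; exists B; rewrite BP !imset_f.
- case=> p [q [-> -> ]]; rewrite -sameE => /existsP[B /and3P[BP pB qB]]; right.
  by apply/existsP; exists B; rewrite BP !imset_f.
Qed.

Lemma stack_edge_sym P Q : symmetric (stack_edge P Q).
Proof.
move=> u v; congr (_ || _); apply: eq_existsb => B; congr (_ && _); exact: andbC.
Qed.

Lemma stack_connect_sym P Q : symmetric (stack_connect P Q).
Proof. exact/sym_connect_sym/stack_edge_sym. Qed.

Lemma stack_upper P Q p q : same P p q -> stack_connect P Q (upper p) (upper q).
Proof. by move=> s; apply/connect1/stack_edgeP; left; exists p, q. Qed.

Lemma stack_lower P Q p q : same Q p q -> stack_connect P Q (lower p) (lower q).
Proof. by move=> s; apply/connect1/stack_edgeP; right; exists p, q. Qed.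

Lemma stack_outer_equiv P Q :
  {in [set: (X + X)%type] & &,
    equivalence_rel (fun x y => stack_connect P Q (outer x) (outer y))}.
Proof.
move=> x y z _ _ _; split=> [|xy]; first exact: connect0.
apply/idP/idP; last exact: connect_trans.
by apply: connect_trans; rewrite -/(stack_connect P Q _ _) stack_connect_sym.
Qed.

Lemma stack_outer_partition P Q : partition (stack_outer P Q) [set: (X + X)%type].
Proof. exact/equivalence_partitionP/stack_outer_equiv. Qed.

Definition setpart_mul P Q : setpart (X + X)%type :=
  SetPart (stack_outer_partition P Q).

Lemma same_mul P Q x y :
  same (setpart_mul P Q) x y = stack_connect P Q (outer x) (outer y).
Proof.
apply: (pblock_equivalence_partition (@stack_outer_equiv P Q)); exact: in_setT.
Qed.

Definition vertical_blocks : {set {set (X + X)}} :=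
  [set [set inl x; inr x] | x : X].

Lemma vertical_partition : partition vertical_blocks [set: (X + X)%type].
Proof.
apply/and3P; split.
- rewrite -subTset; apply/subsetP => p _; apply/bigcupP.
  by case: p => x; (exists [set inl x; inr x];
    [exact: imset_f | rewrite !inE eqxx ?orbT]).
- apply/trivIsetP => _ _ /imsetP[x _ ->] /imsetP[y _ ->] neq.
  rewrite -setI_eq0; apply/eqP/setP => p; rewrite !inE.
  have nxy : x != y by apply: contraNneq neq => ->.
  apply/negP => /andP[/orP[]/eqP-> /orP[]/eqP] // [exy];
  by rewrite exy eqxx in nxy.
- apply/negP => /imsetP[x _ e].
  by have := in_set0 (inl x : X + X); rewrite e !inE eqxx.
Qed.

Definition setpart_one : setpart (X + X)%type := SetPart vertical_partition.

Lemma same_one x y :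
  same setpart_one x y =
    (match x with inl a => a | inr a => a end
       == match y with inl a => a | inr a => a end).
Proof.
set c := fun p : X + X => match p with inl a => a | inr a => a end.
have xB : x \in [set inl (c x); inr (c x)] by case: x => a; rewrite !inE eqxx ?orbT.
have BP : [set inl (c x); inr (c x)] \in setpart_one by apply: imset_f.
rewrite -(same_block y BP xB) -/(c x) -/(c y).
by case: y => b; rewrite !inE /= ?orbF eq_sym.
Qed.

Let Y := (X + X + X + X)%type.

Let zu (z : X + X + X) : Y := inl z.
Let zl (z : X + X + X) : Y :=
  match z with
  | inl (inl m) => inl (inl (inr m))
  | inl (inr b) => inl (inr b)
  | inr b => inr b
  end.

Let oo (p : X + X) : Y :=
  match p with inl t => inl (inl (inl t)) | inr b => inr b end.

Definition tri_edge P Q R : rel Y := fun w w' =>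
  [|| [exists p, exists q, [&& w == zu (upper p), w' == zu (upper q) & same P p q]],
      [exists p, exists q, [&& w == zu (lower p), w' == zu (lower q) & same Q p q]]
    | [exists p, exists q, [&& w == zl (lower p), w' == zl (lower q) & same R p q]]].

Lemma tri_edgeP P Q R w w' :
  reflect ([\/ exists p q, [/\ w = zu (upper p), w' = zu (upper q) & same P p q],
               exists p q, [/\ w = zu (lower p), w' = zu (lower q) & same Q p q]
             | exists p q, [/\ w = zl (lower p), w' = zl (lower q) & same R p q]])
          (tri_edge P Q R w w').
Proof.
apply: (iffP or3P) => [] [].
- by case/existsP=> p /existsP[q /and3P[/eqP-> /eqP-> s]]; constructor 1; exists p, q.
- by case/existsP=> p /existsP[q /and3P[/eqP-> /eqP-> s]]; constructor 2; exists p, q.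
- by case/existsP=> p /existsP[q /and3P[/eqP-> /eqP-> s]]; constructor 3; exists p, q.
- case=> p [q [-> -> s]]; constructor 1.
  by apply/existsP; exists p; apply/existsP; exists q; rewrite !eqxx.
- case=> p [q [-> -> s]]; constructor 2.
  by apply/existsP; exists p; apply/existsP; exists q; rewrite !eqxx.
- case=> p [q [-> -> s]]; constructor 3.
  by apply/existsP; exists p; apply/existsP; exists q; rewrite !eqxx.
Qed.

Let tri P Q R := connect (tri_edge P Q R).

Lemma tri_zu P Q R u v : stack_connect P Q u v -> tri P Q R (zu u) (zu v).
Proof.
move: v; apply: connect_ind => [|v v' uv /stack_edgeP e]; first exact: connect0.
apply: connect_trans uv _; apply/connect1/tri_edgeP.
by case: e => [] [p [q [-> -> s]]]; [constructor 1|constructor 2]; exists p, q.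
Qed.

Lemma tri_zl P Q R u v : stack_connect Q R u v -> tri P Q R (zl u) (zl v).
Proof.
move: v; apply: connect_ind => [|v v' uv /stack_edgeP e]; first exact: connect0.
apply: connect_trans uv _; apply/connect1/tri_edgeP.
case: e => [] [p [q [-> -> s]]]; [constructor 2|constructor 3]; exists p, q => //.
by split=> //; [case: (p)|case: (q)].
Qed.

(* Points of the stacks (P Q, R) and (P, Q R) as points of the stack (P, Q, R). *)

Let mL (z : X + X + X) : Y :=
  match z with inl p => zu (outer p) | inr b => inr b end.
Let mR (z : X + X + X) : Y :=
  match z with inl p => zu (upper p) | inr b => inr b end.

Let mL_lower r : mL (lower r) = zl (lower r). Proof. by case: r. Qed.
Let mL_outer r : mL (outer r) = oo r. Proof. by case: r. Qed.
Let mR_lower r : mR (lower r) = zl (outer r). Proof. by case: r. Qed.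
Let mR_outer r : mR (outer r) = oo r. Proof. by case: r. Qed.
Let mL_inj : injective mL.
Proof. by move=> [[x|x]|x] [[y|y]|y] // [->]. Qed.
Let mR_inj : injective mR.
Proof. by move=> [[x|x]|x] [[y|y]|y] // [->]. Qed.
Let zl_inj : injective zl.
Proof. by move=> [[x|x]|x] [[y|y]|y] // [->]. Qed.

Lemma triL P Q R u w : tri P Q R (mL u) w ->
  exists2 v, stack_connect (setpart_mul P Q) R u v &
    w = mL v \/
    exists z p, [/\ w = zu z, v = upper p & stack_connect P Q (outer p) z].
Proof.
move: w; apply: connect_ind => [|w w' [v uv A] /tri_edgeP e].
  by exists u; [exact: connect0|left].
have PQedge z z' : w = zu z -> w' = zu z' -> stack_connect P Q z z' ->
  exists2 v, stack_connect (setpart_mul P Q) R u v &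
    w' = mL v \/
    exists z p, [/\ w' = zu z, v = upper p & stack_connect P Q (outer p) z].
  move=> wz wz' zz'; exists v => //; right; exists z'.
  case: A => [wv|[t [p [wt vp pt]]]].
    case: v uv wv => [p _|b _]; rewrite wz // => -[zp].
    by exists p; split=> //; rewrite -zp.
  exists p; split=> //; move: wt; rewrite wz => -[zt].
  by apply: connect_trans pt _; rewrite -zt.
case: e => [] [r [r' [er er' s]]].
- by apply: PQedge er er' _; apply: stack_upper.
- by apply: PQedge er er' _; apply: stack_lower.
exists (lower r'); last by left; rewrite mL_lower.
have vr : stack_connect (setpart_mul P Q) R v (lower r).
  case: A => [wv|[t [p [wt -> pt]]]].
    by move: wv; rewrite er -mL_lower => /mL_inj->; apply: connect0.
  case: r er {s} => [m|b]; rewrite wt // => -[et]; rewrite et in pt.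
  by apply: (@stack_upper _ _ p (inr m)); rewrite same_mul.
by apply: connect_trans uv (connect_trans vr _); apply: stack_lower.
Qed.

Lemma triR P Q R u w : tri P Q R (mR u) w ->
  exists2 v, stack_connect P (setpart_mul Q R) u v &
    w = mR v \/
    exists z p, [/\ w = zl z, v = lower p & stack_connect Q R (outer p) z].
Proof.
move: w; apply: connect_ind => [|w w' [v uv A] /tri_edgeP e].
  by exists u; [exact: connect0|left].
have QRedge z z' : w = zl z -> w' = zl z' -> stack_connect Q R z z' ->
  exists2 v, stack_connect P (setpart_mul Q R) u v &
    w' = mR v \/
    exists z p, [/\ w' = zl z, v = lower p & stack_connect Q R (outer p) z].
  move=> wz wz' zz'; exists v => //; right; exists z'.
  case: A => [wv|[t [p [wt vp pt]]]].
    have [p vp] : exists p, v = lower p.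
      case: v uv wv => [[t|m]|b] _.
      - by case: z wz zz' => [[x|x]|x] -> _.
      - by exists (inl m).
      - by exists (inr b).
    move: wv; rewrite vp mR_lower wz => /zl_inj zp.
    by exists p; split=> //; rewrite -zp.
  exists p; split=> //; move: wt; rewrite wz => /zl_inj zt.
  by apply: connect_trans pt _; rewrite -zt.
case: e => [] [r [r' [er er' s]]]; last 1 first.
- by apply: QRedge er er' _; apply: stack_lower.
- exists (upper r'); last by left.
  have vr : stack_connect P (setpart_mul Q R) v (upper r).
    case: A => [wv|[t [p [wt -> pt]]]].
      by move: wv; rewrite er -[zu _]/(mR (upper r)) => /mR_inj->; apply: connect0.
    have [m rm tm] : exists2 m, r = inr m & t = inl (inl m).
      move: wt; rewrite er; case: r {er s} => [x|x]; case: t {pt} => [[y|y]|y] //=.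
      by case=> ->; exists y.
    rewrite rm; rewrite tm in pt.
    by apply: (@stack_lower _ _ p (inl m)); rewrite same_mul.
  by apply: connect_trans uv (connect_trans vr _); apply: stack_upper.
- have zlu q : zu (lower q) = zl (upper q) by case: q.
  rewrite !zlu in er er'.
  by apply: QRedge er er' _; apply: stack_upper.
Qed.

Lemma tri_mL P Q R u v :
  stack_connect (setpart_mul P Q) R u v -> tri P Q R (mL u) (mL v).
Proof.
move: v; apply: connect_ind => [|v v' uv /stack_edgeP e]; first exact: connect0.
apply: connect_trans uv _.
case: e => [] [p [q [-> -> s]]]; first by apply: tri_zu; rewrite -same_mul.
by rewrite !mL_lower; apply: tri_zl; apply: stack_lower.
Qed.

Lemma tri_mR P Q R u v :
  stack_connect P (setpart_mul Q R) u v -> tri P Q R (mR u) (mR v).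
Proof.
move: v; apply: connect_ind => [|v v' uv /stack_edgeP e]; first exact: connect0.
apply: connect_trans uv _.
case: e => [] [p [q [-> -> s]]]; last first.
  by rewrite !mR_lower; apply: tri_zl; rewrite -same_mul.
by apply: (@tri_zu _ _ _ (upper p) (upper q)); apply: stack_upper.
Qed.

Lemma mulL_tri P Q R x y :
  same (setpart_mul (setpart_mul P Q) R) x y = tri P Q R (oo x) (oo y).
Proof.
rewrite same_mul -!mL_outer; apply/idP/idP; first exact: tri_mL.
case/triL=> v xv [/mL_inj->//|[z [p [ez ev pz]]]]; rewrite ev in xv.
apply: connect_trans xv _.
case: y ez => [t [ez]|b //]; rewrite -ez in pz.
by apply: (@stack_upper _ _ p (inl t)); rewrite same_mul.
Qed.

Lemma mulR_tri P Q R x y :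
  same (setpart_mul P (setpart_mul Q R)) x y = tri P Q R (oo x) (oo y).
Proof.
rewrite same_mul -!mR_outer; apply/idP/idP; first exact: tri_mR.
case/triR=> v xv [/mR_inj->//|[z [p [ez ev pz]]]]; rewrite ev in xv.
apply: connect_trans xv _.
case: y ez => [t|b]; case: z pz => [[x'|x']|x'] //= pz [->].
by apply: (@stack_lower P (setpart_mul Q R) p (inr x')); rewrite same_mul.
Qed.

Lemma setpart_mulA : associative setpart_mul.
Proof. by move=> P Q R; apply: setpart_ext => x y; rewrite mulL_tri mulR_tri. Qed.

(* mark_mul b c x: the component of the outer point x in the stack meets a
   point marked by b in the first diagram or by c in the second one.          *)

Definition stack_mark (b c : pred (X + X)) (z : X + X + X) : bool :=
  [exists p, b p && (z == upper p)] || [exists p, c p && (z == lower p)].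

Definition mark_mul P Q (b c : pred (X + X)) : pred (X + X) := fun x =>
  [exists z, stack_connect P Q (outer x) z && stack_mark b c z].

Lemma stack_markP b c z :
  reflect ((exists2 p, b p & z = upper p) \/ (exists2 p, c p & z = lower p))
          (stack_mark b c z).
Proof.
apply: (iffP orP) => [] [].
- by case/existsP=> p /andP[bp /eqP->]; left; exists p.
- by case/existsP=> p /andP[bp /eqP->]; right; exists p.
- by case=> p bp ->; left; apply/existsP; exists p; rewrite bp eqxx.
- by case=> p bp ->; right; apply/existsP; exists p; rewrite bp eqxx.
Qed.

Lemma eq_mark_mul P Q b b' c c' :
  b =1 b' -> c =1 c' -> mark_mul P Q b c =1 mark_mul P Q b' c'.
Proof.
move=> eb ec x; apply: eq_existsb => z; congr (_ && _); congr (_ || _).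
  by apply: eq_existsb => p; rewrite eb.
by apply: eq_existsb => p; rewrite ec.
Qed.

Let mark3 (b c d : pred (X + X)) (w : Y) : Prop :=
  (exists2 z, stack_mark b c z & w = zu z) \/
  (exists2 z, stack_mark c d z & w = zl z).

Lemma mark_mulL P Q R b c d x :
  mark_mul (setpart_mul P Q) R (mark_mul P Q b c) d x <->
  exists2 w, tri P Q R (oo x) w & mark3 b c d w.
Proof.
rewrite -mL_outer; split.
  case/existsP=> z /andP[xz /stack_markP[][p bp ez]]; rewrite ez {z ez} in xz.
    case/existsP: bp => z /andP[pz mz].
    exists (zu z); last by left; exists z.
    by apply: connect_trans (tri_mL xz) _; apply: tri_zu.
  exists (mL (lower p)); first exact: tri_mL.
  right; exists (lower p); last exact: mL_lower.
  by apply/stack_markP; right; exists p.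
case=> w /triL[v xv A].
have upz z : stack_mark b c z -> w = zu z ->
  mark_mul (setpart_mul P Q) R (mark_mul P Q b c) d x.
  move=> mz wz; apply/existsP; exists v; rewrite xv /=.
  have [p vp pz] : exists2 p, v = upper p & stack_connect P Q (outer p) z.
    case: A => [wv|[t [p [wt vp pt]]]].
      move: wv; rewrite wz; case: v {xv} => [p|b'] // [->].
      by exists p => //; exact: connect0.
    by exists p => //; move: wt; rewrite wz => -[->].
  apply/stack_markP; left; exists p => //.
  by apply/existsP; exists z; rewrite pz.
case=> [[z mz wz]|[z /stack_markP[][r cr ->{z}] wr]]; first exact: upz mz wz.
  apply: (upz (lower r)); first by apply/stack_markP; right; exists r.
  by rewrite wr; case: (r).
apply/existsP; exists (lower r); apply/andP; split; last first.
  by apply/stack_markP; right; exists r.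
apply: connect_trans xv _.
case: A => [|[t [p [wt -> pt]]]].
  by rewrite wr -mL_lower => /mL_inj->; apply: connect0.
case: r wr {cr} => [m|b']; rewrite wt // => -[et]; rewrite et in pt.
by apply: (@stack_upper _ _ p (inr m)); rewrite same_mul.
Qed.

Lemma mark_mulR P Q R b c d x :
  mark_mul P (setpart_mul Q R) b (mark_mul Q R c d) x <->
  exists2 w, tri P Q R (oo x) w & mark3 b c d w.
Proof.
rewrite -mR_outer; split.
  case/existsP=> z /andP[xz /stack_markP[][p bp ez]]; rewrite ez {z ez} in xz.
    exists (mR (upper p)); first exact: tri_mR.
    left; exists (upper p) => //.
    by apply/stack_markP; left; exists p.
  case/existsP: bp => z /andP[pz mz].
  exists (zl z); last by right; exists z.
  by apply: connect_trans (tri_mR xz) _; rewrite mR_lower; apply: tri_zl.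
case=> w /triR[v xv A].
have upz z : stack_mark c d z -> w = zl z ->
  mark_mul P (setpart_mul Q R) b (mark_mul Q R c d) x.
  move=> mz wz; apply/existsP; exists v; rewrite xv /=.
  have [p vp pz] : exists2 p, v = lower p & stack_connect Q R (outer p) z.
    case: A => [wv|[t [p [wt vp pt]]]].
      have [p vp] : exists p, v = lower p.
        case: v {xv} wv => [[t|m]|b'].
        - by case: z wz mz => [[y|y]|y] -> _.
        - by exists (inl m).
        - by exists (inr b').
      exists p => //; move: wv; rewrite wz vp mR_lower => /zl_inj->; exact: connect0.
    by exists p => //; move: wt; rewrite wz => /zl_inj->.
  apply/stack_markP; right; exists p => //.
  by apply/existsP; exists z; rewrite pz.
case=> [[z /stack_markP[][r cr ->{z}] wr]|[z mz wz]]; last exact: upz mz wz.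
  apply/existsP; exists (upper r); apply/andP; split; last first.
    by apply/stack_markP; left; exists r.
  apply: connect_trans xv _.
  case: A => [|[t [p [wt -> pt]]]].
    by rewrite wr -[zu _]/(mR (upper r)) => /mR_inj->; apply: connect0.
  have [m rm tm] : exists2 m, r = inr m & t = inl (inl m).
    move: wt; rewrite wr; case: r {wr cr} => [y|y]; case: t {pt} => [[y'|y']|y'] //=.
    by case=> ->; exists y'.
  rewrite rm; rewrite tm in pt.
  by apply: (@stack_lower _ _ p (inl m)); rewrite same_mul.
apply: (upz (upper r)); first by apply/stack_markP; left; exists r.
by rewrite wr; case: (r).
Qed.

Lemma mark_mulA P Q R b c d :
  mark_mul P (setpart_mul Q R) b (mark_mul Q R c d)
    =1 mark_mul (setpart_mul P Q) R (mark_mul P Q b c) d.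
Proof.
by move=> x; apply/idP/idP; [move/mark_mulR/mark_mulL | move/mark_mulL/mark_mulR].
Qed.

Lemma stack_one_lower P p : stack_connect setpart_one P (outer p) (lower p).
Proof.
case: p => x; last exact: connect0.
by apply: (@stack_upper _ _ (inl x) (inr x)); rewrite same_one.
Qed.

Lemma stack_one_upper P p : stack_connect P setpart_one (outer p) (upper p).
Proof.
case: p => x; first exact: connect0.
rewrite -/(stack_connect _ _ _ _) stack_connect_sym.
by apply: (@stack_lower _ _ (inl x) (inr x)); rewrite same_one.
Qed.

Let cl (z : X + X + X) : X + X :=
  match z with inl (inl x) => inl x | inl (inr x) => inl x | inr x => inr x end.
Let cr (z : X + X + X) : X + X :=
  match z with inl (inl x) => inl x | inl (inr x) => inr x | inr x => inr x end.

Let cl_lower p : cl (lower p) = p. Proof. by case: p. Qed.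
Let cr_upper p : cr (upper p) = p. Proof. by case: p. Qed.
Let cl_outer p : cl (outer p) = p. Proof. by case: p. Qed.
Let cr_outer p : cr (outer p) = p. Proof. by case: p. Qed.

Lemma stack_one_cl P u v : stack_connect setpart_one P u v -> same P (cl u) (cl v).
Proof.
move: v; apply: connect_ind => [|v w uv /stack_edgeP e]; first exact: same_refl.
apply: same_trans uv _; case: e => [] [p [q [-> -> s]]]; last by rewrite !cl_lower.
have -> : cl (upper q) = cl (upper p); last exact: same_refl.
by move: s; rewrite same_one; case: p q => x [y|y] /= /eqP->.
Qed.

Lemma stack_one_cr P u v : stack_connect P setpart_one u v -> same P (cr u) (cr v).
Proof.
move: v; apply: connect_ind => [|v w uv /stack_edgeP e]; first exact: same_refl.
apply: same_trans uv _; case: e => [] [p [q [-> -> s]]]; first by rewrite !cr_upper.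
have -> : cr (lower q) = cr (lower p); last exact: same_refl.
by move: s; rewrite same_one; case: p q => x [y|y] /= /eqP->.
Qed.

Lemma setpart_mul1 : left_id setpart_one setpart_mul.
Proof.
move=> P; apply: setpart_ext => x y; rewrite same_mul; apply/idP/idP.
  by move/stack_one_cl; rewrite !cl_outer.
move=> s; apply: connect_trans (stack_one_lower P x) _.
apply: connect_trans (stack_lower _ s) _.
by rewrite -/(stack_connect _ _ _ _) stack_connect_sym stack_one_lower.
Qed.

Lemma setpart_mulr1 : right_id setpart_one setpart_mul.
Proof.
move=> P; apply: setpart_ext => x y; rewrite same_mul; apply/idP/idP.
  by move/stack_one_cr; rewrite !cr_outer.
move=> s; apply: connect_trans (stack_one_upper P x) _.
apply: connect_trans (stack_upper _ s) _.
by rewrite -/(stack_connect _ _ _ _) stack_connect_sym stack_one_upper.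
Qed.

Lemma mark_mul1 P b : (forall x y, same P x y -> b x = b y) ->
  mark_mul setpart_one P pred0 b =1 b.
Proof.
move=> bP x; apply/existsP/idP => [[z /andP[/stack_one_cl xz]]|bx].
  case/stack_markP=> [] [p // bp ez].
  by rewrite cl_outer ez cl_lower in xz; rewrite (bP _ _ xz).
exists (lower x); rewrite stack_one_lower.
by apply/stack_markP; right; exists x.
Qed.

Lemma mark_mulr1 P b : (forall x y, same P x y -> b x = b y) ->
  mark_mul P setpart_one b pred0 =1 b.
Proof.
move=> bP x; apply/existsP/idP => [[z /andP[/stack_one_cr xz]]|bx].
  case/stack_markP=> [] [p // bp ez].
  by rewrite cr_outer ez cr_upper in xz; rewrite (bP _ _ xz).
exists (upper x); rewrite stack_one_upper.
by apply/stack_markP; left; exists x.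
Qed.

End Stack.

(* A component of two involutions without a common fixed point that contains
   a fixed point contains exactly two.                                        *)

Section TwoInvolutions.
Variables (Z : finType) (a b : Z -> Z).
Hypotheses (aK : involutive a) (bK : involutive b).
Hypothesis ab_free : forall w, a w = w -> b w <> w.

Let e : rel Z := fun u v => (v == a u) || (v == b u).

Lemma fixed_component z : a z = z ->
  #|[set w | connect e z w && ((a w == w) || (b w == w))]| = 2.
Proof.
move=> az; pose f w := a (b w).
have f_inj : injective f by apply: inj_comp; apply: can_inj.
have aff w : f (a (f w)) = a w by rewrite /f aK bK.
have afK k : iter k f (a (iter k f z)) = z.
  by elim: k => [|k IHk] //; rewrite iterSr iterS aff.
set m := order f z.
have fm : iter m f z = z by apply: iter_order.
have a_iter k : k <= m -> a (iter k f z) = iter (m - k) f z.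
  have iter_inj : injective (iter k f) by elim: k {afK} => //= k IHk x y /f_inj/IHk.
  move=> km; apply: iter_inj.
  by rewrite afK -iterD subnKC.
have b_iter k : k < m -> b (iter k f z) = iter (m - k.+1) f z.
  by move=> km; rewrite -(a_iter k.+1) //= /f aK.
have iter_eq i j : i < m -> j < m -> (iter i f z == iter j f z) = (i == j).
  move=> im jm; apply/eqP/eqP => [ij|-> //].
  by rewrite -(findex_iter im) -(findex_iter jm) ij.
have m_gt0 : 0 < m by apply: order_gt0.
have m_neq1 : m != 1.
  apply/eqP => m1; move: fm; rewrite m1 /= => fz.
  by apply: (ab_free az); apply: (can_inj aK); rewrite az.
have e_f w : connect e w (f w).
  by apply: (@connect_trans _ _ (b w)); apply: connect1; rewrite /e eqxx ?orbT.
have e_iter k : connect e z (iter k f z).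
  elim: k => [|k IHk] //=; exact: connect_trans IHk (e_f _).
have iter_e w : connect e z w -> exists2 k, k < m & w = iter k f z.
  move: w; apply: connect_ind => [|u v [k km ->]]; first by exists 0.
  case/orP=> /eqP->; last first.
    by exists (m - k.+1); [lia | rewrite b_iter].
  rewrite a_iter; last exact: ltnW.
  case: k km => [|k] km; first by exists 0 => //; rewrite subn0 fm.
  by exists (m - k.+1) => //; lia.
suff -> : [set w | connect e z w && ((a w == w) || (b w == w))]
        = [set z; iter m./2 f z].
  rewrite cards2; suff -> : (z == iter m./2 f z) = false by [].
  by rewrite (iter_eq 0) //; lia.
apply/setP => w; rewrite !inE; apply/andP/orP => [[/iter_e[k km ->]]|].
  rewrite b_iter // iter_eq //; last by lia.
  have -> : (iter k f z == z) = (k == 0) by apply: (iter_eq k 0).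
  case: k km => [|k] km; first by left.
  rewrite a_iter; last exact: ltnW.
  by rewrite !iter_eq; lia.
case=> /eqP->; split; rewrite ?az ?eqxx //.
rewrite a_iter; last by lia.
rewrite b_iter; last by lia.
have [mo|me] := boolP (odd m); apply/orP; [right|left]; apply/eqP.
  by congr (iter _ f z); lia.
by congr (iter _ f z); lia.
Qed.

End TwoInvolutions.

Section Pairings.
Variable T : finType.
Implicit Types (P : setpart T).

Definition pairing (P : {set {set T}}) := [forall A in P, #|A| == 2].

Definition mate P x := odflt x [pick y | same P x y && (y != x)].

Lemma mateP P x y : pairing P -> same P x y = (y == x) || (y == mate P x).
Proof.
move/forall_inP => pP.
have BP : pblock P x \in P by rewrite pblock_mem ?setpart_cover.
have xB : x \in pblock P x by rewrite mem_pblock setpart_cover.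
have [c [d [cd eB]]] := elimT (cards2P _) (pP _ BP).
have s z : same P x z = (z == c) || (z == d) by rewrite /same eB !inE.
rewrite /mate; case: pickP => [z /andP[]|n]; last first.
  have := n c; have := n d; rewrite !s !eqxx orbT /= => /negbFE/eqP ed /negbFE/eqP ec.
  by rewrite ec ed eqxx in cd.
have := same_refl P x; rewrite !s /=.
case/orP=> /eqP-> /orP[]/eqP->; rewrite ?eqxx // => _.
exact: orbC.
Qed.

Lemma mate_neq P x : pairing P -> mate P x != x.
Proof.
move/forall_inP => pP; rewrite /mate; case: pickP => [z /andP[]//|n] /=.
have BP : pblock P x \in P by rewrite pblock_mem ?setpart_cover.
have [c [d [cd eB]]] := elimT (cards2P _) (pP _ BP).
have s z : same P x z = (z == c) || (z == d) by rewrite /same eB !inE.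
have := n c; have := n d; rewrite !s !eqxx orbT /= => /negbFE/eqP ed /negbFE/eqP ec.
by rewrite ec ed eqxx in cd.
Qed.

Lemma mate_same P x : pairing P -> same P x (mate P x).
Proof. by move=> pP; rewrite mateP // eqxx orbT. Qed.

Lemma mateK P : pairing P -> involutive (mate P).
Proof.
move=> pP x; have := mate_same x pP; rewrite same_sym mateP //.
case/orP=> /eqP e; last by rewrite -e.
by move: (mate_neq x pP); rewrite -e eqxx.
Qed.

Lemma pairing_parity P (f g : T -> nat) : pairing P ->
  (forall c d, c != d -> same P c d -> odd (f c + f d) = odd (g c + g d)) ->
  odd (\sum_c f c) = odd (\sum_c g c).
Proof.
move=> /forall_inP pP fg.
have cov h : \sum_c h c = \sum_(c in cover P) h c.
  by apply: eq_bigl => c; rewrite setpart_cover.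
rewrite !cov !big_trivIset ?setpart_triv //=.
apply: (big_ind2 (fun i j => odd i = odd j)) => // [i j k l|A AP].
  by rewrite !oddD => -> ->.
have [c [d [cd eA]]] := elimT (cards2P _) (pP _ AP).
rewrite eA !big_setU1 ?inE // !big_set1; apply: fg => //.
by rewrite -(same_block _ AP) eA !inE eqxx ?orbT.
Qed.

End Pairings.

Section PairingMul.
Variables (X : finType) (P Q : setpart (X + X)%type).
Hypotheses (pP : pairing P) (pQ : pairing Q).

Let a (z : X + X + X) := match z with
  | inl w => inl (mate P w) | inr z => inr z end.
Let b (z : X + X + X) := match z with
  | inl (inl t) => inl (inl t)
  | inl (inr m) => lower (mate Q (inl m))
  | inr z => lower (mate Q (inr z)) end.

Let aK : involutive a.
Proof. by case=> [w|z] //=; rewrite mateK. Qed.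

Let b_lower p : b (lower p) = lower (mate Q p). Proof. by case: p. Qed.

Let bK : involutive b.
Proof. by case=> [[t|m]|z] //=; rewrite b_lower mateK. Qed.

Let a_fix z : (a z == z) = (if z is inr _ then true else false).
Proof.
case: z => [w|z] /=; last exact: eqxx.
by apply/negP => /eqP[e]; move: (mate_neq w pP); rewrite e eqxx.
Qed.

Let b_fix z : (b z == z) = (if z is inl (inl _) then true else false).
Proof.
case: z => [[t|m]|z] /=; first exact: eqxx.
  apply/negP => /eqP/(@lower_inj _ _ (inl m)) e.
  by move: (mate_neq (inl m) pQ); rewrite e eqxx.
apply/negP => /eqP/(@lower_inj _ _ (inr z)) e.
by move: (mate_neq (inr z) pQ); rewrite e eqxx.
Qed.

Let conn u v : stack_connect P Q u v = connect (fun u v => (v == a u) || (v == b u)) u v.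
Proof.
apply/idP/idP; move: u v; apply: connect_sub => u v.
  case/stack_edgeP=> [] [p [q [-> -> ]]]; rewrite mateP // => /orP[]/eqP->.
  - exact: connect0.
  - by apply: connect1; rewrite /= eqxx.
  - exact: connect0.
  - by apply: connect1; rewrite b_lower eqxx orbT.
case/orP=> /eqP->.
  case: u => [w|z]; last exact: connect0.
  by apply: stack_upper; apply: mate_same.
case: u => [[t|m]|z]; first exact: connect0.
  by apply: (@stack_lower _ P Q (inl m)); apply: mate_same.
by apply: (@stack_lower _ P Q (inr z)); apply: mate_same.
Qed.

Lemma pairing_mul : pairing (setpart_mul P Q).
Proof.
apply/forall_inP => A AR; have [x xA] := block_nonempty AR.
rewrite -(card_imset _ (@outer_inj X)).
suff -> : [set outer y | y in A] =
    [set w | stack_connect P Q (outer x) w && ((a w == w) || (b w == w))].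
  have abf w : a w = w -> b w <> w.
    by move/eqP; rewrite a_fix => aw /eqP; rewrite b_fix; case: w aw.
  have baf w : b w = w -> a w <> w by move=> bw aw; exact: abf aw bw.
  case: x xA => x xA; apply/eqP.
    have bx : b (outer (inl x)) = outer (inl x) by apply/eqP; rewrite b_fix.
    rewrite -[RHS](fixed_component bK aK baf bx).
    apply: eq_card => w; rewrite !inE conn orbC; congr (_ && _).
    by apply: eq_connect => u v /=; rewrite orbC.
  have ax : a (outer (inr x)) = outer (inr x) by apply/eqP; rewrite a_fix.
  rewrite -[RHS](fixed_component aK bK abf ax).
  by apply: eq_card => w; rewrite !inE conn.
apply/setP => w; rewrite inE a_fix b_fix; apply/imsetP/andP => [[y yA ->]|[xw]].
  by rewrite -same_mul -(same_block y AR xA) yA; case: (y).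
case: w xw => [[t|//]|z] xw _.
  by exists (inl t) => //; rewrite (same_block _ AR xA) same_mul.
by exists (inr z) => //; rewrite (same_block _ AR xA) same_mul.
Qed.

End PairingMul.

Section Planar.
Variable n : nat.

(* TL-diagrams on n points: the point inl i (resp. inr i) stands for i.+1
   (resp. (i.+1)'), and a diagram up to isotopy is determined by its
   noncrossing matching.  The points are ordered along the boundary of the
   strip, clockwise starting from its left end: 1 < ... < n < n' < ... < 1'.  *)

Definition pt := ('I_n + 'I_n)%type.

Definition rk (p : pt) : nat :=
  match p with inl i => i | inr i => n + rev_ord i end.

Definition noncrossing (P : {set {set pt}}) :=
  [forall A in P, forall B in P, (A != B) ==>
    [forall a in A, forall b in A, forall c in B, forall d in B,
      ~~ [&& rk a < rk c, rk c < rk b & rk b < rk d]]].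

(* Of the two parts into which an arc cuts the strip, the one away from the
   left side has on its boundary the points ranked between the endpoints of
   the arc.  Hence an arc lies on the boundary of the left side iff no arc of
   the diagram has its two endpoints around those of that arc.                *)

Definition encloses (B A : {set pt}) :=
  [exists c in B, exists d in B, forall a in A, (rk c < rk a) && (rk a < rk d)].

Definition left_exposed (P : {set {set pt}}) (A : {set pt}) :=
  ~~ [exists B in P, encloses B A].

Implicit Types (P Q : setpart pt) (S : pred pt) (T : pred ('I_n + 'I_n + 'I_n)).

Lemma rk_inj : injective rk.
Proof.
move=> [i|i] [j|j] /=; have := ltn_ord i; have := ltn_ord j => jn iN e;
  try (by exfalso; lia); congr (_ _); apply: val_inj => /=; lia.
Qed.

Lemma noncrossingP P :
  reflect (forall a b c d, same P a b -> same P c d -> ~~ same P a c ->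
             ~ [/\ rk a < rk c, rk c < rk b & rk b < rk d])
          (noncrossing P).
Proof.
have pbP p : pblock P p \in P by rewrite pblock_mem ?setpart_cover.
apply: (iffP idP) => [nc a b c d ab cd ac lt|nc].
  move/forall_inP: nc => /(_ _ (pbP a))/forall_inP/(_ _ (pbP c))/implyP.
  have -> : pblock P a != pblock P c.
    by rewrite eq_pblock ?setpart_triv ?setpart_cover.
  move=> /(_ isT)/forall_inP/(_ a (same_refl P a))/forall_inP/(_ b ab).
  move=> /forall_inP/(_ c (same_refl P c))/forall_inP/(_ d cd).
  by case/negP; apply/and3P.
apply/forall_inP => A AP; apply/forall_inP => B BP; apply/implyP => AB.
apply/forall_inP => a aA; apply/forall_inP => b bA.
apply/forall_inP => c cB; apply/forall_inP => d dB.
apply/negP => /and3P lt; apply: nc lt.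
- by rewrite -(same_block _ AP).
- by rewrite -(same_block _ BP).
- rewrite -(same_block _ AP aA); apply: contraNN AB => cA.
  by rewrite -(def_pblock (setpart_triv P) AP cA) (def_pblock (setpart_triv P) BP cB).
Qed.

Lemma crossing_parity x y c d :
  ~ [/\ x < c, c < y & y < d] -> ~ [/\ x < d, d < y & y < c] ->
  ~ [/\ y < c, c < x & x < d] -> ~ [/\ y < d, d < x & x < c] ->
  ~ [/\ c < x, x < d & d < y] -> ~ [/\ d < x, x < c & c < y] ->
  ~ [/\ c < y, y < d & d < x] -> ~ [/\ d < y, y < c & c < x] ->
  x != c -> x != d -> y != c -> y != d ->
  odd ((c < x) + (d < x)) = odd ((c < y) + (d < y)).
Proof.
move=> a1 a2 a3 a4 b1 b2 b3 b4.
rewrite !neq_ltn => /orP[]xc /orP[]xd /orP[]yc /orP[]yd;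
  rewrite ?xc ?xd ?yc ?yd ?[c < x]ltnNge ?[d < x]ltnNge ?[c < y]ltnNge
    ?[d < y]ltnNge ?(ltnW xc) ?(ltnW xd) ?(ltnW yc) ?(ltnW yd) //=; exfalso.
all: by [apply: a1 | apply: a2 | apply: a3 | apply: a4
        | apply: b1 | apply: b2 | apply: b3 | apply: b4].
Qed.

Definition depth S x := odd (\sum_s (S s && (rk s < rk x))).

Definition block_closed P S := forall s t, same P s t -> S s = S t.

Lemma depth_block P S x y : pairing P -> noncrossing P -> block_closed P S ->
  same P x y -> ~~ S x -> depth S x = depth S y.
Proof.
move=> pP /noncrossingP nc cl xy Sx; apply: (pairing_parity pP) => c d cd scd.
rewrite -(cl c d scd); have [Sc|_] := boolP (S c) => //=.
have xc : ~~ same P x c by apply: contraNN Sx => /cl->.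
have diff p q : same P x p -> same P c q -> rk p != rk q.
  move=> xp cq; apply: contraNneq xc => /rk_inj pq.
  by apply: same_trans xp _; rewrite pq same_sym.
have nc1 p p' q q' : same P x p -> same P x p' -> same P c q -> same P c q' ->
    ~ [/\ rk p < rk q, rk q < rk p' & rk p' < rk q'].
  move=> xp xp' cq cq'; apply: nc.
  - by apply: same_trans xp'; rewrite same_sym.
  - by apply: same_trans cq'; rewrite same_sym.
  - apply: contraNN xc => pq; apply: same_trans xp _; apply: same_trans pq _.
    by rewrite same_sym.
have nc2 p p' q q' : same P x p -> same P x p' -> same P c q -> same P c q' ->
    ~ [/\ rk q < rk p, rk p < rk q' & rk q' < rk p'].
  move=> xp xp' cq cq'; apply: nc.
  - by apply: same_trans cq'; rewrite same_sym.
  - by apply: same_trans xp'; rewrite same_sym.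
  - apply: contraNN xc => pq; apply: same_trans xp _; rewrite same_sym.
    exact: same_trans cq pq.
have [xx cc] := (same_refl P x, same_refl P c).
have := (diff x c xx cc, diff x d xx scd, diff y c xy cc, diff y d xy scd).
have := (nc1 x y c d xx xy cc scd, nc1 x y d c xx xy scd cc,
         nc1 y x c d xy xx cc scd, nc1 y x d c xy xx scd cc).
have := (nc2 x y c d xx xy cc scd, nc2 x y d c xx xy scd cc,
         nc2 y x c d xy xx cc scd, nc2 y x d c xy xx scd cc).
move=> [[[a1 a2] a3] a4] [[[b1 b2] b3] b4] [[[d1 d2] d3] d4].
exact: crossing_parity.
Qed.

Lemma depth_exposed P S A x : pairing P -> noncrossing P -> block_closed P S ->
  A \in P -> left_exposed P A -> x \in A -> ~~ S x -> depth S x = false.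
Proof.
move=> pP /noncrossingP nc cl AP ex xA Sx.
transitivity (odd (\sum_(s : pt) 0)); last by rewrite big1.
apply: (pairing_parity pP) => c d cd scd.
rewrite -(cl c d scd); have [Sc|_] := boolP (S c) => //=.
wlog ltcd : c d cd scd Sc / rk c < rk d => [hw|].
  case: (ltngtP (rk c) (rk d)) => [|dc|/rk_inj e]; first exact: hw.
    by rewrite addnC; apply: hw => //; rewrite ?(eq_sym d) 1?same_sym -?(cl _ _ scd).
  by rewrite e eqxx in cd.
have xc : ~~ same P x c by apply: contraNN Sx => /cl->.
have diff p q : same P x p -> same P c q -> rk p != rk q.
  move=> xp cq; apply: contraNneq xc => /rk_inj pq.
  by apply: same_trans xp _; rewrite pq same_sym.
have dx := diff x d (same_refl P x) scd.
case: (ltnP (rk d) (rk x)) => h1; case: (ltnP (rk c) (rk x)) => h2 //=;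
  first by move: (leq_trans (ltn_trans ltcd h1) h2); rewrite ltnn.
have ltxd : rk x < rk d by rewrite ltn_neqAle dx h1.
case/negP: ex; apply/existsP; exists (pblock P c).
rewrite pblock_mem ?setpart_cover //=; apply/existsP; exists c.
rewrite mem_pblock setpart_cover /=; apply/existsP; exists d.
rewrite [d \in _]scd /=; apply/forall_inP => y yA.
have xy : same P x y by rewrite -(same_block y AP xA).
have dyc := diff y c xy (same_refl P c).
have dyd := diff y d xy scd.
apply/andP; split; rewrite ltnNge; apply/negP => h3.
  apply: (nc y x c d).
  - by rewrite same_sym.
  - exact: scd.
  - by apply: contraNN xc => yc; apply: same_trans xy yc.
  - by split=> //; rewrite ltn_neqAle dyc.
apply: (nc c d x y) => //.
- by rewrite same_sym.
- by split=> //; rewrite ltn_neqAle eq_sym dyd.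
Qed.

Lemma closed_even P S : pairing P -> block_closed P S -> odd (\sum_s S s) = false.
Proof.
move=> pP cl; transitivity (odd (\sum_(s : pt) 0)); last by rewrite big1.
apply: (pairing_parity pP) => c d _ scd.
by rewrite -(cl c d scd); case: (S c).
Qed.

Lemma sum_split (m : pred 'I_n) (s : 'I_n) : ~~ m s ->
  \sum_i m i = \sum_i (m i && (i < s)%N) + \sum_i (m i && (s < i)%N).
Proof.
move=> ms; rewrite -big_split /=; apply: eq_bigr => i _.
have [mi|//] := boolP (m i); case: ltngtP => //= /val_inj e.
by rewrite -e mi in ms.
Qed.

Lemma depth_inl S i : depth S (inl i) = odd (\sum_j (S (inl j) && (j < i)%N)).
Proof.
rewrite /depth big_sumType /= [X in _ + X]big1 ?addn0 // => j _.
by rewrite ltnNge (leq_trans (ltnW (ltn_ord i))) ?leq_addr // andbF.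
Qed.

Lemma depth_inr S i : depth S (inr i) =
  odd (\sum_j S (inl j) + \sum_j (S (inr j) && (i < j)%N)).
Proof.
rewrite /depth big_sumType /=; congr (odd (_ + _)); apply: eq_bigr => j _.
  by rewrite (leq_trans (ltn_ord j)) ?leq_addr // andbT.
by congr (nat_of_bool (_ && _)); have := ltn_ord i; have := ltn_ord j; lia.
Qed.

Definition stack_depth T (z : 'I_n + 'I_n + 'I_n) := match z with
  | inl w => depth (T \o @upper _) w
  | inr b => depth (T \o @lower _) (inr b) end.

Section Component.
Variables (P Q : setpart pt) (T : pred ('I_n + 'I_n + 'I_n)).
Hypotheses (pP : pairing P) (pQ : pairing Q).
Hypotheses (nP : noncrossing P) (nQ : noncrossing Q).
Hypotheses (TP : block_closed P (T \o @upper _)) (TQ : block_closed Q (T \o @lower _)).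

Let evP := closed_even pP TP.
Let evQ := closed_even pQ TQ.

Lemma stack_depth_lower w : ~~ T (lower w) -> stack_depth T (lower w) = depth (T \o @lower _) w.
Proof.
case: w => i //= Ti; rewrite depth_inr depth_inl.
move: evP; rewrite big_sumType /= (sum_split (m := fun i => T (inl (inr i))) Ti).
rewrite !oddD /=; do !case: (odd _) => //=.
Qed.

Lemma stack_depth_outer x : ~~ T (outer x) -> stack_depth T (outer x) = depth (T \o @outer _) x.
Proof.
case: x => i /= Ti; first by rewrite !depth_inl.
rewrite !depth_inr; move: evP; rewrite big_sumType !oddD /=.
by do !case: (odd _) => //=.
Qed.

Lemma stack_depth_connect u v : ~~ T u -> stack_connect P Q u v -> stack_depth T u = stack_depth T v.
Proof.
move=> Tu uv; suff [] : ~~ T v /\ stack_depth T u = stack_depth T v by [].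
move: v uv; apply: connect_ind => // v w [Tv ->] /stack_edgeP[] [p [q [ev ew s]]].
  rewrite ev in Tv; rewrite ev ew; split; first by rewrite -[T _](TP s).
  exact: (depth_block pP nP TP s).
rewrite ev in Tv; have Tw : ~~ T (lower q) by rewrite -[T _](TQ s).
rewrite ev ew; split=> //; rewrite !stack_depth_lower //.
exact: (depth_block pQ nQ TQ s).
Qed.

End Component.
End Planar.

Section PlanarMul.
Variable n : nat.
Implicit Types (P Q : setpart (pt n)).

Lemma component_upper P Q z :
  block_closed P (stack_connect P Q z \o @upper _).
Proof. by move=> s t st; apply/(same_connect_r (@stack_connect_sym _ P Q))/stack_upper. Qed.

Lemma component_lower P Q z :
  block_closed Q (stack_connect P Q z \o @lower _).
Proof. by move=> s t st; apply/(same_connect_r (@stack_connect_sym _ P Q))/stack_lower. Qed.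

Lemma mul_component P Q x y :
  (stack_connect P Q (outer x) \o @outer _) y = same (setpart_mul P Q) x y.
Proof. by rewrite same_mul. Qed.

Lemma depth_pair (S : pred (pt n)) a b x : a != b -> S =1 pred2 a b ->
  depth S x = ((rk a < rk x) (+) (rk b < rk x)).
Proof.
move=> ab eS; rewrite /depth (bigD1 a) //= (bigD1 b) 1?eq_sym //= big1.
  by rewrite !eS /= !eqxx orbT addn0 oddD !oddb.
by move=> c /andP[ca cb]; rewrite eS /= (negPf ca) (negPf cb).
Qed.

Lemma block_pair P x y : pairing P -> same P x y -> x != y ->
  same P x =1 pred2 x y.
Proof.
move=> pP; rewrite (mateP _ _ pP) => /orP[/eqP->|/eqP->]; first by rewrite eqxx.
by move=> _ z; rewrite mateP.
Qed.

Lemma noncrossing_mul P Q : pairing P -> pairing Q ->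
  noncrossing P -> noncrossing Q -> noncrossing (setpart_mul P Q).
Proof.
move=> pP pQ nP nQ; apply/noncrossingP => a b c d ab cd ac [l1 l2 l3].
have nab : a != b by apply: contraTneq (ltn_trans l1 l2) => ->; rewrite ltnn.
have eS y : (stack_connect P Q (outer a) \o @outer _) y = pred2 a b y.
  by rewrite mul_component (block_pair (pairing_mul pP pQ) ab nab).
rewrite same_mul in ac; rewrite same_mul in cd.
have Dc := stack_depth_connect pP pQ nP nQ (@component_upper P Q (outer a))
  (@component_lower P Q (outer a)) ac cd.
have ad : ~~ stack_connect P Q (outer a) (outer d).
  apply: contraNN ac => ad; apply: connect_trans ad _.
  by rewrite -/(stack_connect _ _ _ _) stack_connect_sym.
move: Dc; rewrite !(stack_depth_outer pP (@component_upper P Q (outer a))) //.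
rewrite !(depth_pair _ nab eS) l1 l3 (ltn_trans (ltn_trans l1 l2) l3).
by rewrite ltnNge (ltnW l2).
Qed.

Lemma depth_mark P Q (B C : {set {set pt n}}) (T : pred ('I_n + 'I_n + 'I_n)) x :
  pairing P -> pairing Q -> noncrossing P -> noncrossing Q ->
  block_closed P (T \o @upper _) -> block_closed Q (T \o @lower _) ->
  B \subset P -> {in B, forall A, left_exposed P A} ->
  C \subset Q -> {in C, forall A, left_exposed Q A} ->
  mark_mul P Q [in cover B] [in cover C] x -> ~~ T (outer x) ->
  (forall z, stack_connect P Q (outer x) z -> ~~ T z) ->
  depth (T \o @outer _) x = false.
Proof.
move=> pP pQ nP nQ TP TQ BP eB CQ eC /existsP[z /andP[xz mz]] Tx /(_ z xz) Tz.
rewrite -(stack_depth_outer pP TP Tx) (stack_depth_connect pP pQ nP nQ TP TQ Tx xz).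
case/stack_markP: mz => [] [p /bigcupP[A AB pA] ez].
  rewrite ez in Tz *.
  exact: (depth_exposed pP nP TP (subsetP BP _ AB) (eB _ AB) pA).
rewrite ez in Tz *; rewrite (stack_depth_lower pP TP Tz).
exact: (depth_exposed pQ nQ TQ (subsetP CQ _ AB) (eC _ AB) pA).
Qed.

Lemma left_exposed_mul P Q (B C : {set {set pt n}}) A x :
  pairing P -> pairing Q -> noncrossing P -> noncrossing Q ->
  B \subset P -> {in B, forall A, left_exposed P A} ->
  C \subset Q -> {in C, forall A, left_exposed Q A} ->
  A \in setpart_mul P Q -> x \in A ->
  mark_mul P Q [in cover B] [in cover C] x ->
  left_exposed (setpart_mul P Q) A.
Proof.
move=> pP pQ nP nQ BP eB CQ eC AR xA mx; apply/negP => /existsP[E /andP[ER]].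
case/existsP=> c /andP[cE /existsP[d /andP[dE /forall_inP enc]]].
have /andP[cx xd] := enc x xA.
have cd : same (setpart_mul P Q) c d by rewrite -(same_block d ER cE).
have ncd : c != d by apply: contraTneq (ltn_trans cx xd) => ->; rewrite ltnn.
have eS y : (stack_connect P Q (outer c) \o @outer _) y = pred2 c d y.
  by rewrite mul_component (block_pair (pairing_mul pP pQ) cd ncd).
have Tx : ~~ stack_connect P Q (outer c) (outer x).
  have := eS x; rewrite /= => ->; apply/norP.
  by split; apply/eqP => e; rewrite e ltnn in cx xd.
have := depth_mark pP pQ nP nQ (@component_upper P Q (outer c))
  (@component_lower P Q (outer c)) BP eB CQ eC mx Tx.
rewrite (depth_pair x ncd eS) cx [rk d < _]ltnNge (ltnW xd) => h.
suff /h : forall z, stack_connect P Q (outer x) z -> ~~ stack_connect P Q (outer c) z.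
  by [].
move=> z xz; apply: contraNN Tx => cz.
by apply: connect_trans cz _; rewrite -/(stack_connect _ _ _ _) stack_connect_sym.
Qed.

End PlanarMul.

Lemma partition_by (T : finType) (P : {set {set T}}) (g : T -> {set T}) :
  (forall p, g p \in P) -> (forall p, p \in g p) ->
  (forall B, B \in P -> B != set0 /\ forall p, p \in B -> B = g p) ->
  partition P [set: T].
Proof.
move=> gP gp PB; apply/and3P; split.
- rewrite -subTset; apply/subsetP => p _; apply/bigcupP; exists (g p) => //.
- apply/trivIsetP => A B /PB[_ Ag] /PB[_ Bg]; apply: contraR.
  by case/pred0Pn=> p /andP[/= /Ag-> /Bg->].
- by apply/negP => /PB[]; rewrite eqxx.
Qed.

Definition partition_monoid (X : finType) := setpart (X + X)%type.

HB.instance Definition _ (X : finType) := Finite.on (partition_monoid X).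
HB.instance Definition _ (X : finType) :=
  isMonoid.Build (partition_monoid X)
    (@setpart_mulA X) (@setpart_mul1 X) (@setpart_mulr1 X).

Section Generators.
Variables (X : finType) (a b : X).

Definition vertical_away : {set {set (X + X)}} :=
  [set [set inl k; inr k] | k : X & (k != a) && (k != b)].

Definition cup_cap_blocks : {set {set (X + X)}} :=
  [set inl a; inl b] |: ([set inr a; inr b] |: vertical_away).

Definition join_blocks : {set {set (X + X)}} :=
  [set inl a; inl b; inr a; inr b] |: vertical_away.

Let away k := (k != a) && (k != b).

Let away_mem k : away k -> [set inl k; inr k] \in vertical_away.
Proof. by move=> h; apply/imsetP; exists k; rewrite ?inE. Qed.

Let gc (p : X + X) : {set (X + X)} := match p with
  | inl k => if away k then [set inl k; inr k] else [set inl a; inl b]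
  | inr k => if away k then [set inl k; inr k] else [set inr a; inr b] end.

Let gcP p : gc p \in cup_cap_blocks.
Proof.
rewrite !inE; case: p => k /=; case: ifP => h; rewrite ?eqxx ?orbT //.
  by rewrite away_mem ?orbT.
by rewrite away_mem ?orbT.
Qed.

Let gcB p : p \in gc p.
Proof.
case: p => k /=; case: ifP => h; rewrite !inE ?eqxx ?orbT //.
  by move: h; rewrite /away -negb_or => /negbFE.
by move: h; rewrite /away -negb_or => /negbFE.
Qed.

Let gcE B p : B \in cup_cap_blocks -> p \in B -> B = gc p.
Proof.
rewrite !inE => /or3P[/eqP->|/eqP->|/imsetP[k]]; last first.
  by rewrite inE -/(away k) => h -> /set2P[]->; rewrite /= h.
all: by case/set2P=> ->; rewrite /= /away !eqxx ?andbF.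
Qed.

Lemma cup_cap_partition : partition cup_cap_blocks [set: (X + X)%type].
Proof.
apply: (partition_by gcP gcB) => B BP; split=> [|p]; last exact: gcE.
apply/set0Pn; move: BP; rewrite !inE => /or3P[/eqP->|/eqP->|/imsetP[k _ ->]].
- by exists (inl a); rewrite !inE eqxx.
- by exists (inr a); rewrite !inE eqxx.
- by exists (inl k); rewrite !inE eqxx.
Qed.

Definition cup_cap : partition_monoid X := SetPart cup_cap_partition.

Lemma same_cup_cap p q : same cup_cap p q = (q \in gc p).
Proof. by rewrite -(same_block q (gcP p : _ \in cup_cap) (gcB p)). Qed.

Lemma pairing_cup_cap : a != b -> pairing cup_cap.
Proof.
move=> ab; apply/forall_inP => B /=.
rewrite !inE => /or3P[/eqP->|/eqP->|/imsetP[k _ ->]]; rewrite cards2 eqSS eqb1 //.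
Qed.

Let gj (p : X + X) : {set (X + X)} :=
  let k := match p with inl k => k | inr k => k end in
  if away k then [set inl k; inr k] else [set inl a; inl b; inr a; inr b].

Lemma join_partition : partition join_blocks [set: (X + X)%type].
Proof.
apply: (@partition_by _ _ gj) => [p|p|B].
- rewrite !inE /gj; case: p => k /=; case: ifP => h; rewrite ?eqxx //.
    by rewrite away_mem ?orbT.
  by rewrite away_mem ?orbT.
- rewrite /gj; case: p => k /=; case: ifP => h; rewrite !inE ?eqxx ?orbT //.
    by move: h; rewrite /away -negb_or => /negbFE; rewrite !orbF.
  by move: h; rewrite /away -negb_or => /negbFE.
rewrite !inE => /orP[/eqP->|/imsetP[k]].
  split; first by apply/set0Pn; exists (inl a); rewrite !inE eqxx.
  move=> p; rewrite !inE -!orbA /gj.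
  by case/or4P=> /eqP->; rewrite /= /away !eqxx ?andbF.
rewrite inE -/(away k) => h ->; split.
  by apply/set0Pn; exists (inl k); rewrite !inE eqxx.
by move=> p /set2P[]->; rewrite /gj h.
Qed.

Definition join_part : partition_monoid X := SetPart join_partition.

End Generators.

Lemma same_cup_capE (X : finType) (a b : X) p q :
  same (cup_cap a b) p q =
  match p, q with
  | inl x, inl y => (x == y) || ((x \in [:: a; b]) && (y \in [:: a; b]))
  | inr x, inr y => (x == y) || ((x \in [:: a; b]) && (y \in [:: a; b]))
  | inl x, inr y => (x == y) && (x \notin [:: a; b])
  | inr x, inl y => (x == y) && (x \notin [:: a; b])
  end.
Proof.
have i1 (x y : X) : (inl x == inl y :> X + X) = (x == y) by [].
have i2 (x y : X) : (inr x == inr y :> X + X) = (x == y) by [].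
rewrite same_cup_cap; case: p q => x [] y; case: ifP => h;
  rewrite !inE ?i1 ?i2 ?orbF ?negb_or ?h ?andbT ?andbF //=;
  rewrite ?(eq_sym y x) //; move: h.
all: have [->|_] := x =P y; do !case: (_ == _) => //=.
Qed.

Lemma same_oneE (X : finType) p q :
  same (setpart_one X) p q =
  match p, q with inl x, inl y | inr x, inr y | inl x, inr y | inr x, inl y => x == y end.
Proof. by rewrite same_one; case: p q => x [] y. Qed.

(* bl_val is a TL-diagram together with the set of its blobbed arcs.          *)

Definition is_blobbed n (D : setpart (pt n) * {set {set pt n}}) :=
  [&& pairing D.1, noncrossing D.1, D.2 \subset blocks D.1
    & [forall A in D.2, left_exposed D.1 A]].

Record Bl n := Blobbed {
  bl_val : setpart (pt n) * {set {set pt n}};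
  bl_valP : is_blobbed bl_val }.

HB.instance Definition _ n := [isSub for @bl_val n].
HB.instance Definition _ n := [Finite of Bl n by <:].

Definition arcs n (D : Bl n) : setpart (pt n) := (bl_val D).1.
Definition blobs n (D : Bl n) : {set {set pt n}} := (bl_val D).2.

Section BlMonoid.
Variable n : nat.
Implicit Types D E F : Bl n.

Definition blobbed D (p : pt n) := p \in cover (blobs D).

Lemma pairing_arcs D : pairing (arcs D).
Proof. by have /and4P[] := bl_valP D. Qed.

Lemma noncrossing_arcs D : noncrossing (arcs D).
Proof. by have /and4P[] := bl_valP D. Qed.

Lemma blobs_sub D : blobs D \subset blocks (arcs D).
Proof. by have /and4P[] := bl_valP D. Qed.

Lemma blobs_exposed D : {in blobs D, forall A, left_exposed (arcs D) A}.
Proof. by have /and4P[_ _ _ /forall_inP] := bl_valP D. Qed.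

Lemma mem_blobs D A x : A \in arcs D -> x \in A -> (A \in blobs D) = blobbed D x.
Proof.
move=> AP xA; apply/idP/bigcupP => [AB|[B BB xB]]; first by exists A.
have BP := subsetP (blobs_sub D) _ BB.
by rewrite -(def_pblock (setpart_triv (arcs D)) AP xA)
  (def_pblock (setpart_triv (arcs D)) BP xB).
Qed.

Lemma blobbed_same D x y : same (arcs D) x y -> blobbed D x = blobbed D y.
Proof.
move=> xy; have BP : pblock (arcs D) x \in arcs D by rewrite pblock_mem ?setpart_cover.
by rewrite -(mem_blobs BP xy) (mem_blobs BP (same_refl _ x)).
Qed.

Lemma Bl_ext D E : arcs D = arcs E -> blobbed D =1 blobbed E -> D = E.
Proof.
move=> eA eB; apply: val_inj; rewrite /= [LHS]surjective_pairing [RHS]surjective_pairing.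
congr (_, _) => //; apply/setP => A; apply/idP/idP => AB.
  have AP := subsetP (blobs_sub D) _ AB; have [x xA] := block_nonempty AP.
  by rewrite -/(blobs E) (mem_blobs (x := x)) -?eA // -eB -(mem_blobs AP xA).
have AP := subsetP (blobs_sub E) _ AB; have [x xA] := block_nonempty AP.
by rewrite -/(blobs D) (mem_blobs (x := x)) ?eA // eB -(mem_blobs AP xA).
Qed.

(* In a product, an arc is blobbed iff its component in the stack meets a
   blobbed arc of a factor; closed loops disappear with the middle row.       *)

Definition bl_mul_val D E : setpart (pt n) * {set {set pt n}} :=
  let R := setpart_mul (arcs D) (arcs E) in
  (R, [set A in blocks R
      | [exists x in A, mark_mul (arcs D) (arcs E) (blobbed D) (blobbed E) x]]).

Lemma bl_mul_valP D E : is_blobbed (bl_mul_val D E).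
Proof.
have [pD nD] := (pairing_arcs D, noncrossing_arcs D).
have [pE nE] := (pairing_arcs E, noncrossing_arcs E).
apply/and4P; split.
- exact: pairing_mul.
- exact: noncrossing_mul.
- by apply/subsetP => A; rewrite inE => /andP[].
apply/forall_inP => A; rewrite inE => /andP[AR /existsP[x /andP[xA mx]]].
exact: (left_exposed_mul pD pE nD nE (blobs_sub D) (@blobs_exposed D)
  (blobs_sub E) (@blobs_exposed E) AR xA mx).
Qed.

Definition bl_mul D E : Bl n := Blobbed (bl_mul_valP D E).

Lemma blobbed_mul D E :
  blobbed (bl_mul D E) =1 mark_mul (arcs D) (arcs E) (blobbed D) (blobbed E).
Proof.
move=> x; set R := arcs (bl_mul D E).
have BP : pblock R x \in R by rewrite pblock_mem ?setpart_cover.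
rewrite -(mem_blobs BP (same_refl R x)) inE BP /=.
apply/existsP/idP => [[y /andP[xy my]]|mx]; last first.
  by exists x; rewrite mx andbT; exact: (same_refl R x).
have {}xy : same (setpart_mul (arcs D) (arcs E)) x y by [].
rewrite same_mul in xy; case/existsP: my => z /andP[yz mz].
by apply/existsP; exists z; rewrite mz andbT; apply: connect_trans xy yz.
Qed.

Lemma bl_one_valP : is_blobbed (setpart_one 'I_n, set0).
Proof.
apply/and4P; split; rewrite ?sub0set //; last by apply/forall_inP => A; rewrite inE.
  by apply/forall_inP => _ /imsetP[k _ ->]; rewrite cards2.
apply/noncrossingP => a b c d; rewrite !same_oneE /=.
case: a b c d => a [] b [] c [] d /= /eqP <- /eqP <- /eqP nac [];
  have := ltn_ord a; have := ltn_ord c; move: nac; lia.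
Qed.

Definition bl_one : Bl n := Blobbed bl_one_valP.

Lemma blobbed_one : blobbed bl_one =1 pred0.
Proof. by move=> x; rewrite /blobbed /cover big_set0 inE. Qed.

Lemma bl_mulA : associative bl_mul.
Proof.
move=> D E F; apply: Bl_ext; first exact: setpart_mulA.
move=> x; rewrite !blobbed_mul.
rewrite (eq_mark_mul _ _ (frefl (blobbed D)) (blobbed_mul E F)).
rewrite (eq_mark_mul _ _ (blobbed_mul D E) (frefl (blobbed F))).
exact: mark_mulA.
Qed.

Lemma bl_mul1 : left_id bl_one bl_mul.
Proof.
move=> D; apply: Bl_ext; first exact: setpart_mul1.
move=> x; rewrite blobbed_mul (eq_mark_mul _ _ blobbed_one (frefl (blobbed D))).
exact: (mark_mul1 (@blobbed_same D)).
Qed.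

Lemma bl_mulr1 : right_id bl_one bl_mul.
Proof.
move=> D; apply: Bl_ext; first exact: setpart_mulr1.
move=> x; rewrite blobbed_mul (eq_mark_mul _ _ (frefl (blobbed D)) blobbed_one).
exact: (mark_mulr1 (@blobbed_same D)).
Qed.

(* Generators; for i = 0 the point i stands for 1, and for i > 0 the points
   ord_pred i and i stand for i and i.+1.                                     *)

Definition bl_gen_val (i : 'I_n) : setpart (pt n) * {set {set pt n}} :=
  if i == 0 :> nat then (setpart_one 'I_n, [set [set inl i; inr i]])
  else (cup_cap (ord_pred i) i, set0).

Lemma bl_gen_valP i : is_blobbed (bl_gen_val i).
Proof.
have /and4P[p1 n1 _ _] := bl_one_valP.
rewrite /bl_gen_val; have [i0|i0] := eqVneq (i : nat) 0; apply/and4P; split=> //=.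
- by rewrite sub1set; apply: imset_f.
- apply/forall_inP => _ /set1P->; apply/negP => /existsP[B /andP[_]].
  case/existsP=> c /andP[_ /existsP[d /andP[_ /forall_inP/(_ (inl i))]]].
  by rewrite !inE eqxx /= i0 => /(_ isT).
- apply: pairing_cup_cap; apply/eqP => /(congr1 val) /=.
  have := ltn_ord i; case: (val i) i0 => // k _ kn.
  by rewrite addSn /= modnDr modn_small ?(ltnW kn) // => /eqP; rewrite ltn_eqF.
- have pi : (ord_pred i).+1 = i :> nat.
    have := ltn_ord i; rewrite /=; case: (val i) i0 => // k _ kn.
    by rewrite addSn /= modnDr modn_small // ltnW.
  move: (ord_pred i) pi => j ji.
  apply/(@noncrossingP _ (cup_cap j i)) => a b c d; rewrite !same_cup_capE /=.
  case: a b c d => a [] b [] c [] d; rewrite !inE -!val_eqE /=;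
  have := ltn_ord a; have := ltn_ord b; have := ltn_ord c; have := ltn_ord d;
  move: (nat_of_ord a) (nat_of_ord b) (nat_of_ord c) (nat_of_ord d) ji;
  move=> {}a {}b {}c {}d ji la lb lc ld h1 h2 h3 [h4 h5 h6]; lia.
- by rewrite sub0set.
- by apply/forall_inP => A; rewrite inE.
Qed.

Definition bl_gen i : Bl n := Blobbed (bl_gen_valP i).

End BlMonoid.

HB.instance Definition _ n :=
  isMonoid.Build (Bl n) (@bl_mulA n) (@bl_mul1 n) (@bl_mulr1 n).

(* The points 0, ..., n are the elements of 'I_n.+1; the ordinals a and b below
   are i and i.+1.  The cup-cap partition contains the block {0, 0'}.         *)

Section Hook.
Variable n : nat.
Local Open Scope group_scope.

Definition hook_gen (i : 'I_n) : partition_monoid 'I_n.+1 :=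
  let a := widen_ord (leqnSn n) i in
  let b := lift ord0 i in
  if i == 0%N :> nat then join_part a b else cup_cap a b.

Definition is_submonoid (X : finType) (S : {set partition_monoid X}) :=
  (1 \in S) && [forall P in S, forall Q in S, P * Q \in S].

Definition hook_set : {set partition_monoid 'I_n.+1} :=
  \bigcap_(S : {set partition_monoid 'I_n.+1}
            | is_submonoid S && [forall i, hook_gen i \in S]) S.

Record hook := Hook { hook_val :> partition_monoid 'I_n.+1; _ : hook_val \in hook_set }.

HB.instance Definition _ := [isSub for hook_val].
HB.instance Definition _ := [Finite of hook by <:].

Lemma hook_closed : monoid_closed (mem hook_set).
Proof.
split=> [|P Q /bigcapP hP /bigcapP hQ]; apply/bigcapP => S SG;
  have /andP[/andP[S1 /forall_inP SM] _] := SG; first exact: S1.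
by have /forall_inP := SM P (hP S SG); apply; apply: hQ.
Qed.

HB.instance Definition _ :=
  SubChoice_isSubMonoid.Build _ _ hook hook_closed.

End Hook.

(* Main.v *)
(* A blobbed diagram D is sent to the partition obtained by adding the points 0
   and 0' and merging them with all blobbed arcs into one block.  This is
   multiplicative because a component of a stack is blobbed iff it is joined to
   that block.  It is injective because blobbed arcs are exposed: no two of them
   are nested, so each pairs two consecutive blobbed points.

   Its image is the hook blob monoid because the u_i generate all blobbed
   diagrams, by induction on a weighted width that plays the role of word length
   in type B.  If the arc of 1 is blobbed, u_0 can be factored out on the left.
   Otherwise take the leftmost cup {i, i+1} of the top row; it is unblobbed.  Let
   q be the first point on the right of the vertical line through its middle
   whose arc crosses the line or is blobbed, and let p be the other end of that
   arc.  Replacing {i, i+1} and {p, q} by {i, p}, with the blob of {p, q} if any,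
   and the unblobbed arc {i+1, q} gives a narrower diagram D' with D = u_i D'.
   Without cups in the top row, D is the identity. *)

Require Import Defs.
From mathcomp Require Import all_boot.
From HB Require Import structures.
From mathcomp Require Import perm zify.

Set Implicit Arguments.
Unset Strict Implicit.
Unset Printing Implicit Defensive.

(** * Matchings obtained from fixed-point-free involutions *)

Definition keypart (T : finType) (K : eqType) (k : T -> K) : setpart T :=
  SetPart (preim_partitionP k [set: T]).

Lemma same_keypart (T : finType) (K : eqType) (k : T -> K) x y :
  same (keypart k) x y = (k x == k y).
Proof.
rewrite /same pblock_equivalence_partition ?inE // => {}x {}y z _ _ _.
by split=> // /eqP->.
Qed.

Section MatchingOf.
Variables (T : finType) (f : T -> T).
Hypotheses (fK : involutive f) (f_free : forall x, f x != x).

Definition matching : setpart T := keypart (fun x => [set x; f x]).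

Lemma same_matching x y : same matching x y = (y == x) || (y == f x).
Proof.
rewrite same_keypart; apply/eqP/orP => [e|[]/eqP->] //.
  by have := set21 y (f y); rewrite -e !inE => /orP.
by rewrite fK setUC.
Qed.

Lemma pairing_matching : pairing matching.
Proof.
apply/forall_inP => A AP; have [x xA] := block_nonempty AP.
have -> : A = [set x; f x].
  by apply/setP => y; rewrite (same_block y AP xA) same_matching !inE.
by rewrite cards2 (eq_sym x) f_free.
Qed.

Lemma mate_matching : mate matching =1 f.
Proof.
move=> x; have := mate_same x pairing_matching.
rewrite same_matching => /orP[]/eqP// e.
by have := mate_neq x pairing_matching; rewrite e eqxx.
Qed.

End MatchingOf.

Lemma mate_inj (T : finType) (P Q : setpart T) :
  pairing P -> pairing Q -> mate P =1 mate Q -> P = Q.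
Proof. by move=> pP pQ e; apply: setpart_ext => x y; rewrite !mateP // e. Qed.

(** * Blobbed diagrams as planar involutions with a set of exposed points *)

Section Diagrams.
Variable n : nat.
Implicit Types (f : pt n -> pt n) (b : pred (pt n)) (D : Bl n).

(** For [z] different from both ends this says that [z] lies between them, in either order of the
    ends. The exclusive or makes it symmetric in the ends and additive along paths. *)
Definition betw (x y z : nat) := (x < z) (+) (y < z).

(** Noncrossing as a parity condition: no arc separates the two ends of another. This avoids a case
    distinction on the order of the four ends. *)
Definition planar f := forall x z, z != x -> z != f x ->
  betw (rk x) (rk (f x)) (rk z) = betw (rk x) (rk (f x)) (rk (f z)).

Definition exposed f x := forall y,
  ~~ [&& rk y < rk x, rk y < rk (f x), rk x < rk (f y) & rk (f x) < rk (f y)].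

Lemma rk_neq (x y : pt n) : x != y -> rk x != rk y.
Proof. by apply: contra => /eqP/rk_inj->. Qed.

(** [noncrossing] forbids a single order of four named ends. Its eight instances, for the choice of
    the first arc and for the naming of the ends, exclude every crossing. *)
Lemma planar_mate D : planar (mate (arcs D)).
Proof.
set f := mate _ => x z zx zfx.
have pD := pairing_arcs D; have fK : involutive f := mateK pD.
have fx := mate_neq x pD; have fz := mate_neq z pD.
have nc (a c : pt n) : c != a -> c != f a ->
   ~~ [&& rk a < rk c, rk c < rk (f a) & rk (f a) < rk (f c)].
  move=> ca cfa; apply/negP => /and3P; apply: (elimT (noncrossingP _) (noncrossing_arcs D)).
  - exact: mate_same.
  - exact: mate_same.
  by rewrite mateP // (negPf ca) (negPf cfa).
have fzx : f z != x by apply: contraNneq zfx => <-; rewrite fK.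
have fzfx : f z != f x by apply: contraNneq zx => /(can_inj fK)->.
have := nc x z zx zfx; have := nc x (f z) fzx fzfx.
have := nc (f x) z zfx; have := nc (f x) (f z) fzfx; rewrite !fK => h1 h2.
move: (h1 fzx) (h2 zx) => {}h1 {}h2.
have xz : x != z by rewrite eq_sym.
have xfz : x != f z by rewrite eq_sym.
have fxz : f x != z by rewrite eq_sym.
have fxfz : f x != f z by rewrite eq_sym.
have h3 := nc z x xz xfz; have h4 := nc z (f x) fxz fxfz.
have h5 := nc (f z) x xfz; have h6 := nc (f z) (f x) fxfz; rewrite !fK in h4 h5 h6.
move: (h5 xz) (h6 fxz) => {}h5 {}h6 h7 h8.
have := rk_neq zx; have := rk_neq zfx; have := rk_neq fzx; have := rk_neq fzfx.
rewrite /betw; move: (rk x) (rk z) (rk (f x)) (rk (f z)) h1 h2 h3 h4 h5 h6 h7 h8; clear.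
lia.
Qed.

Lemma exposed_mate D x : blobbed D x -> exposed (mate (arcs D)) x.
Proof.
have pD := pairing_arcs D.
case/bigcupP=> A AB xA y; apply/negP => /and4P[h1 h2 h3 h4].
have AP := subsetP (blobs_sub D) _ AB.
have /negP := blobs_exposed AB; apply; apply/existsP.
exists (pblock (arcs D) y); rewrite pblock_mem ?setpart_cover //=.
apply/existsP; exists y; rewrite mem_pblock setpart_cover /=.
apply/existsP; exists (mate (arcs D) y); rewrite [_ \in _]mate_same //=.
apply/forall_inP => z; rewrite (same_block _ AP xA) mateP // => /orP[]/eqP->.
  by rewrite h1.
by rewrite h2.
Qed.

Section Build.
Variables (f : pt n -> pt n) (b : pred (pt n)).
Hypotheses (fK : involutive f) (f_free : forall x, f x != x) (pf : planar f).
Hypotheses (bf : forall x, b (f x) = b x) (eb : forall x, b x -> exposed f x).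

Let val := (matching f, [set A in blocks (matching f) | [exists x in A, b x]]).

Lemma diagram_valP : is_blobbed val.
Proof.
apply/and4P; split=> /=.
- exact: pairing_matching.
- apply/(@noncrossingP _ (matching f)) => x y z w; rewrite !same_matching // => yx wz.
  rewrite negb_or => /andP[zx zfx] [].
  case/orP: yx => /eqP->; first by lia.
  case/orP: wz => /eqP->; first by lia.
  have := pf zx zfx; rewrite /betw; lia.
- by apply/subsetP => A; rewrite inE => /andP[].
have block C u v : C \in matching f -> u \in C -> (v \in C) = (v == u) || (v == f u).
  by move=> CP uC; rewrite (same_block v CP uC) same_matching.
apply/forall_inP => A; rewrite inE => /andP[AP /existsP[x /andP[xA bx]]].
apply/negP => /existsP[B /andP[BP /existsP[y /andP[yB /existsP[z /andP[zB]]]]]].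
move=> /forall_inP h; have := h x xA; have := h (f x).
rewrite (block _ _ _ AP xA) eqxx orbT => /(_ isT).
have := eb bx y; move: zB; rewrite (block _ _ _ BP yB).
by case/orP=> /eqP->; move: (rk x) (rk y) (rk (f x)) (rk (f y)); clear; lia.
Qed.

Definition diagram : Bl n := Blobbed diagram_valP.

Lemma mate_diagram : mate (arcs diagram) =1 f.
Proof. exact: mate_matching. Qed.

Lemma blobbed_diagram : blobbed diagram =1 b.
Proof.
move=> x; set P := matching f.
have BP : pblock P x \in P by rewrite pblock_mem ?setpart_cover.
rewrite -(@mem_blobs _ diagram _ x BP (same_refl P x)) inE BP /=.
apply/existsP/idP => [[y /andP[xy]]|bx]; last first.
  by exists x; rewrite bx andbT; exact: (same_refl P x).
have {}xy : same P x y by [].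
by move: xy; rewrite same_matching // => /orP[]/eqP->; rewrite ?bf.
Qed.

End Build.

Lemma diagram_ext D E : mate (arcs D) =1 mate (arcs E) -> blobbed D =1 blobbed E -> D = E.
Proof. by move=> e; apply/Bl_ext/mate_inj/e; apply: pairing_arcs. Qed.

Lemma blobbed_mate D x : blobbed D (mate (arcs D) x) = blobbed D x.
Proof. by rewrite -(blobbed_same (D := D) (mate_same x (pairing_arcs D))). Qed.

End Diagrams.

(** * Vertical lines of the strip and the width of a diagram *)

Definition idx n (p : pt n) : nat := match p with inl k => k | inr k => k end.

Lemma ltn_idx n (p : pt n) : idx p < n. Proof. by case: p => k /=. Qed.

Lemma rkE n (p : pt n) :
  rk p = (if p is inl _ then idx p else n + (n - (idx p).+1)).
Proof. by case: p. Qed.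

(** The points on the right of a vertical line are consecutive along the boundary, so crossing the
    line can be read off ranks. *)
Lemma idx_rk n (p : pt n) i : i <= n -> (i <= idx p) = (i <= rk p < 2 * n - i).
Proof. by have := ltn_idx p; rewrite rkE; case: p => k /=; lia. Qed.

Lemma betwC x y z : betw x y z = betw y x z. Proof. exact: addbC. Qed.

(** Crossing is symmetric in the two chords, so either of them may be taken as the separating
    one. *)
Lemma betw_swap (x x' z z' : nat) : x != z -> x != z' -> x' != z -> x' != z' ->
  (betw x x' z == betw x x' z') = (betw z z' x == betw z z' x').
Proof. rewrite /betw; clear; lia. Qed.

Lemma betw_path x y z w s : betw x w s = betw x y s (+) betw y z s (+) betw z w s.
Proof. by rewrite /betw; case: (x < s); case: (y < s); case: (z < s); case: (w < s). Qed.

(* The number of vertical lines met by the arc of x, where a blobbed arc is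
   pulled to the left side of the strip.  Each generator of a reduced word
   accounts for two of these crossings. *)
Definition weight n (D : Bl n) (x : pt n) : nat :=
  let y := mate (arcs D) x in
  if blobbed D x then (idx x).+1 + (idx y).+1
  else (idx x - idx y) + (idx y - idx x).

Definition width n (D : Bl n) : nat := \sum_x weight D x.

(** * Factoring a generator out of a cup of the top row *)

Section Surgery.
Variables (n : nat) (D : Bl n) (i : 'I_n).
Let f := mate (arcs D).
Let b := blobbed D.
Let c : pt n := inl (ord_pred i).
Let c1 : pt n := inl i.
Hypotheses (i0 : 0 < i) (fc : f c = c1) (nb : ~~ b c1).

Let pD := pairing_arcs D.
Let fK : involutive f. Proof. exact: mateK. Qed.
Let f_free x : f x != x. Proof. exact: mate_neq. Qed.
Let bf x : b (f x) = b x. Proof. exact: blobbed_mate. Qed.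
Let pf : planar f. Proof. exact: planar_mate. Qed.
Let ef x : b x -> exposed f x. Proof. exact: exposed_mate. Qed.

Lemma ord_predS : (ord_pred i).+1 = i :> nat.
Proof.
have := ltn_ord i; rewrite /=; case: (val i) i0 => // k _ kn.
by rewrite addSn /= modnDr modn_small // ltnW.
Qed.

Let rc : (rk c).+1 = i. Proof. exact: ord_predS. Qed.
Let rc1 : rk c1 = i. Proof. by []. Qed.
Let fc1 : f c1 = c. Proof. by rewrite -fc fK. Qed.

(* The points on the right of the vertical line between c and c1 whose arc
   crosses that line, or is tied by its blob to the left side. *)
Definition reach y := [&& y != c1, i <= idx y & (idx (f y) < i) || b y].

(** Otherwise the points other than [c1] on the right of the line would be closed under [f]. Their
    number is odd, since the top row has lost [c1], which contradicts the pairing. A point of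
    minimal rank is then taken. *)
Lemma reach_exists : exists2 q, reach q & forall y, rk y < rk q -> ~~ reach y.
Proof.
have [q0 rq0] : exists q0, reach q0.
  apply/existsP; apply: contraT; rewrite negb_exists => /forallP no.
  have nS y : y != c1 -> i <= idx y -> (f y != c1) && (i <= idx (f y)).
    move=> yc1 iy; have := no y; rewrite /reach yc1 iy /= negb_or -leqNgt.
    case/andP=> -> _; rewrite andbT; apply: contraTneq iy => e.
    by rewrite -(fK y) e fc1 /= -ltnNge; move: rc => /=; clear; lia.
  pose S y := (y != c1) && (i <= idx y).
  have Sf y : S y -> S (f y) by case/andP=> /nS h /h.
  have cl : block_closed (arcs D) S.
    move=> s t; rewrite mateP // => /orP[]/eqP->//.
    by apply/idP/idP => [/Sf//|/Sf]; rewrite fK.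
  have := closed_even pD cl; rewrite big_sumType /=.
  suff -> : \sum_(k < n) S (inr k) = (\sum_(k < n) S (inl k)).+1.
    by rewrite addnS /= addnn odd_double.
  rewrite (bigD1 i) //= [in RHS](bigD1 i) //= /S eqxx /= leqnn add0n add1n.
  by congr _.+1; apply: eq_bigr => k ki; rewrite (_ : inl k != c1).
case: (arg_minnP (@rk n) rq0) => q rq qm; exists q => // y.
by apply: contraTN => /qm; rewrite -leqNgt.
Qed.

Variable q : pt n.
Hypotheses (rq : reach q) (qmin : forall y, rk y < rk q -> ~~ reach y).
Let p := f q.
Let t := tperm c q.

(* The arcs [c, c1] and [p, q] exchange their endpoints [c] and [q]. *)
Definition surgery (x : pt n) : pt n := t (f (t x)).
Definition surgery_blob (x : pt n) : bool := b (t x).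
Let g := surgery.

Let iq : i <= idx q. Proof. by have /and3P[] := rq. Qed.
Let iqr : i <= rk q < 2 * n - i. Proof. by rewrite -idx_rk // ltnW. Qed.
Let qc1 : q != c1. Proof. by have /and3P[] := rq. Qed.
Let qc : q != c.
Proof. by apply: contraTneq iq => ->; move: rc => /=; clear; lia. Qed.
Let pc : p != c. Proof. by rewrite -fc1 (can_eq fK). Qed.
Let pc1 : p != c1. Proof. by rewrite -fc (can_eq fK). Qed.
Let pq : p != q. Proof. exact: f_free. Qed.
Let cc1 : c != c1. Proof. by rewrite -fc eq_sym f_free. Qed.
Let fp : f p = q. Proof. exact: fK. Qed.

Let other x := [&& x != c, x != c1, x != p & x != q].

Let other_f x : other x -> other (f x).
Proof.
have e u v : f u = v -> (f x != v) = (x != u) by move<-; rewrite (can_eq fK).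
by case/and4P=> ? ? ? ?; rewrite /other (e c1) // (e c) // (e q) // (e p) //; apply/and4P.
Qed.

Lemma tE x : other x -> t x = x.
Proof. by case/and4P=> xc _ _ xq; rewrite tpermD // eq_sym. Qed.

Let gc : g c = p. Proof. by rewrite /g /surgery tpermL tpermD // eq_sym. Qed.
Let gp : g p = c. Proof. by rewrite /g /surgery [t p]tpermD ?fp ?tpermR // eq_sym. Qed.
Let gc1 : g c1 = q. Proof. by rewrite /g /surgery [t c1]tpermD ?fc1 ?tpermL. Qed.
Let gq : g q = c1. Proof. by rewrite /g /surgery tpermR fc tpermD. Qed.
Let go x : other x -> g x = f x.
Proof. by move=> ox; rewrite /g /surgery (tE ox) tE ?other_f. Qed.

Let class x : (x = c \/ x = p) \/ (x = c1 \/ x = q) \/ other x.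
Proof.
rewrite /other; case: eqP => [->|_]; first by do 2 left.
case: eqP => [->|_]; first by right; left; left.
case: eqP => [->|_]; first by left; right.
by case: eqP => [->|_]; [right; left; right|right; right].
Qed.

(* By minimality of q. *)
Let inner z : rk c1 < rk z < rk q -> i <= rk (f z) < 2 * n - i /\ b z = false.
Proof.
move=> /andP[h1 h2]; have := qmin h2; rewrite /reach.
have iz : i <= idx z.
  by rewrite idx_rk; [move: iqr h1 h2; rewrite -rc1; clear; lia | exact: ltnW].
have -> : z != c1 by apply: contraTneq h1 => ->; rewrite ltnn.
rewrite iz /= negb_or -leqNgt idx_rk; last exact: ltnW.
by case/andP=> -> /negPf.
Qed.

Let bq : i <= rk p < 2 * n - i -> b q.
Proof.
rewrite -idx_rk; last exact: ltnW.
by have /and3P[_ _] := rq; rewrite ltnNge -/p => /orP[/negPf->|].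
Qed.

Let rkcq : rk c1 < rk q.
Proof. by move: (rk_neq qc1) iqr; rewrite rc1; clear; lia. Qed.

Let p_out : ~~ (rk c1 < rk p < rk q).
Proof.
apply/negP => h; have [] := inner h; rewrite -/p bf => _ /negP; apply.
by apply: bq; move: iqr h; rewrite rc1; clear; lia.
Qed.

(** An arc leaving the interval past [q] cannot cross {p, q}, so [p] lies under it and hence on the
    right of the line. Then [q] is blobbed by [bq], although the arc {p, q} is enclosed. *)
Let inner_stable z : other z -> rk c1 < rk z < rk q -> rk c1 < rk (f z) < rk q.
Proof.
move=> oz h; have [ifz bz] := inner h; have ofz := other_f oz.
have [fzc1 fzq] : rk (f z) != rk c1 /\ rk (f z) != rk q.
  by case/and4P: ofz => _ h1 _ h2; rewrite !rk_neq.
have [//|zq] := ltnP (rk (f z)) (rk q); first by move: ifz fzc1; rewrite rc1; clear; lia.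
have qz : q != z by rewrite eq_sym; case/and4P: oz.
have qfz : q != f z by rewrite eq_sym; case/and4P: ofz.
have := pf qz qfz; rewrite /betw -/p.
have pz : rk p != rk z by rewrite eq_sym; case/and4P: oz => _ _ /rk_neq.
have pfz : rk p != rk (f z) by rewrite eq_sym; case/and4P: ofz => _ _ /rk_neq.
move=> hp; have ezp : rk z < rk p < rk (f z).
  by move: hp h zq pz pfz (rk_neq qz) (rk_neq qfz); clear; lia.
have Bq : b q by apply: bq; move: ezp h ifz; rewrite rc1; clear; lia.
by have := ef Bq z; move: ezp h zq (rk_neq qfz); rewrite -/p; clear; lia.
Qed.

Let out_q z : other z -> betw (rk c1) (rk q) (rk z) = betw (rk c1) (rk q) (rk (f z)).
Proof.
move=> oz; have h1 := inner_stable oz; have := inner_stable (other_f oz).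
have /and4P[_ a1 _ a2] := oz; have /and4P[_ b1 _ b2] := other_f oz.
move: rkcq h1 (rk_neq a1) (rk_neq a2) (rk_neq b1) (rk_neq b2); rewrite fK /betw.
move: (rk c1) (rk q) (rk z) (rk (f z)); clear; lia.
Qed.

(** Separation adds up along the path [c], [c1], [q], [p], whose steps are the old cup, the new arc
    {c1, q} and the old arc {p, q}. None of them separates the ends of another arc. *)
Let out_p z : other z -> betw (rk c) (rk p) (rk z) = betw (rk c) (rk p) (rk (f z)).
Proof.
move=> oz; have h1 := out_q oz.
have /and4P[zc zc1 zp zq] := oz; have /and4P[fzc fzc1 fzp fzq] := other_f oz.
have h2 : betw (rk c) (rk c1) (rk z) = betw (rk c) (rk c1) (rk (f z)).
  by rewrite -fc; apply: pf => //; rewrite fc.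
by rewrite !(betw_path (rk c) (rk c1) (rk q) (rk p)) h1 h2 (pf zq zp).
Qed.

Lemma surgery_invol : involutive g.
Proof. by move=> x; rewrite /g /surgery tpermK fK tpermK. Qed.

Lemma surgery_free x : g x != x.
Proof. by rewrite -(can_eq (tpermK c q)) tpermK f_free. Qed.

(** The new arcs do not cross each other, because [c] and [c1] are adjacent and [p] is not between
    [c1] and [q]. Towards the unchanged arcs [out_p] and [out_q] apply, with the roles exchanged by
    [swap] when needed. *)
Lemma planar_surgery : planar g.
Proof.
have e1 : betw (rk c) (rk p) (rk c1) = betw (rk c) (rk p) (rk q).
  rewrite /betw; move: rc rc1 rkcq p_out (rk_neq pc) (rk_neq pc1) (rk_neq pq).
  move: (rk c) (rk p) (rk c1) (rk q); clear; lia.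
have e2 : betw (rk c1) (rk q) (rk c) = betw (rk c1) (rk q) (rk p).
  rewrite /betw; move: rc rc1 rkcq p_out (rk_neq pc) (rk_neq pc1) (rk_neq pq).
  move: (rk c) (rk p) (rk c1) (rk q); clear; lia.
have swap x z w : other x -> ~~ other z -> ~~ other w ->
    betw (rk z) (rk w) (rk x) = betw (rk z) (rk w) (rk (f x)) ->
    betw (rk x) (rk (f x)) (rk z) = betw (rk x) (rk (f x)) (rk w).
  move=> ox oz ow /eqP e; apply/eqP; rewrite betw_swap //; apply: rk_neq.
  - by apply: contraNneq oz => <-.
  - by apply: contraNneq ow => <-.
  - by apply: contraNneq oz => <-; apply: other_f.
  - by apply: contraNneq ow => <-; apply: other_f.
have oc : ~~ other c by rewrite /other eqxx.
have oc1 : ~~ other c1 by rewrite /other eqxx andbF.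
have op : ~~ other p by rewrite /other eqxx !andbF.
have oq : ~~ other q by rewrite /other eqxx !andbF.
move=> x z.
case: (class x) => [[|]->|[[|]->|ox]]; case: (class z) => [[|]->|[[|]->|oz]];
  rewrite ?gc ?gp ?gc1 ?gq ?eqxx // => zx zgx; rewrite ?(go oz);
  rewrite ?[betw (rk p) (rk c) _]betwC ?[betw (rk q) (rk c1) _]betwC //.
all: try by [apply: out_p | apply: out_q].
all: rewrite (go ox) in zgx *.
all: try exact: pf.
all: apply: swap => //; rewrite ?[betw (rk p) (rk c) _]betwC ?[betw (rk q) (rk c1) _]betwC.
all: by [apply: out_p | apply: out_q].
Qed.

Lemma surgery_blob_mate x : surgery_blob (g x) = surgery_blob x.
Proof. by rewrite /surgery_blob tpermK bf. Qed.

Let exposed_g x : exposed g x -> exposed g (g x).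
Proof.
move=> ex y; move: (ex y); rewrite surgery_invol.
by move: (rk _ < rk x) (rk _ < rk (g x)) (rk x < _) (rk (g x) < _) => [] [] [] [].
Qed.

Lemma surgery_exposed x : surgery_blob x -> exposed g x.
Proof.
have cp_exposed : b q -> exposed g c.
  move=> Bq y; rewrite gc.
  case: (class y) => [[|]->|[[|]->|oy]]; rewrite ?gc ?gp ?gc1 ?gq.
  - by rewrite ltnn.
  - by rewrite ltnn !andbF.
  - by move: rc rc1; move: (rk c) (rk c1); clear; lia.
  - by move: rc rc1 rkcq; move: (rk c) (rk c1) (rk q); clear; lia.
  (* An arc around {c, p} does not separate [p] from [q], so it is also around {p, q}, against the
     exposure of [q]. *)
  have /and4P[yc yc1 yp yq] := oy; have /and4P[_ fyc1 _ _] := other_f oy.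
  have qy : q != y by rewrite eq_sym.
  have qfy : q != f y by rewrite eq_sym; case/and4P: (other_f oy).
  have := pf qy qfy; have := ef Bq y; rewrite (go oy) -/p /betw.
  move: rc rc1 rkcq (rk_neq yc1) (rk_neq fyc1) (rk_neq qy) (rk_neq qfy).
  move: (rk c) (rk p) (rk c1) (rk q) (rk y) (rk (f y)); clear; lia.
rewrite /surgery_blob; case: (class x) => [[|]->|[[|]->|ox]].
- by rewrite tpermL; apply: cp_exposed.
- have -> : b (t p) = b q by rewrite [t p]tpermD ?bf // eq_sym.
  by move/cp_exposed/exposed_g; rewrite gc.
- by rewrite [t c1]tpermD // (negPf nb).
- by rewrite tpermR -bf fc (negPf nb).
rewrite tE // => bx.
have bfx : b (f x) by rewrite bf.
(* Blobbed points avoid the interval from [c1] to [q]. Hence {c1, q} is not around [x], and if {c,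
   p} were, then so would be the old arc {p, q}. *)
have in1 z : b z -> ~~ (rk c1 < rk z < rk q) by move=> bz; apply/negP => /inner[_]; rewrite bz.
have /and4P[xc xc1 xp xq] := ox; have /and4P[fxc fxc1 fxp fxq] := other_f ox.
move=> y; rewrite go //; case: (class y) => [[|]->|[[|]->|oy]]; rewrite ?gc ?gp ?gc1 ?gq.
- have := ef bx q; rewrite -/p; move: (in1 _ bx) (in1 _ bfx) rc rc1 rkcq p_out.
  move: (rk_neq xq) (rk_neq fxq) (rk_neq xc1) (rk_neq fxc1) (rk_neq pq) (rk_neq pc1).
  move: (rk c) (rk p) (rk c1) (rk q) (rk x) (rk (f x)); clear; lia.
- have := ef bx p; rewrite fp; move: rc rc1 rkcq.
  move: (rk c) (rk p) (rk c1) (rk q) (rk x) (rk (f x)); clear; lia.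
- have := in1 _ bx; move: (rk c1) (rk q) (rk x) (rk (f x)); clear; lia.
- by move: rkcq; move: (rk c1) (rk q) (rk x) (rk (f x)); clear; lia.
by rewrite go //; apply: ef.
Qed.

Definition reduced : Bl n :=
  diagram surgery_invol surgery_free planar_surgery surgery_exposed.

Let arcE x : mate (arcs reduced) x = g x. Proof. exact: mate_diagram. Qed.
Let blobE x : blobbed reduced x = surgery_blob x.
Proof. exact/blobbed_diagram/surgery_blob_mate. Qed.

Let C := cup_cap (ord_pred i) i.
Let R := arcs reduced.

Let arcs_gen : arcs (bl_gen i) = C.
Proof. by rewrite /arcs /= /bl_gen_val -[_ == 0]negbK -lt0n i0. Qed.

Let blobbed_gen : blobbed (bl_gen i) =1 pred0.
Proof.
move=> x; rewrite /blobbed /blobs /= /bl_gen_val -[_ == 0]negbK -lt0n i0 /=.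
by rewrite /cover big_set0 inE.
Qed.

Let pR : pairing R. Proof. exact: pairing_arcs. Qed.

Let conn_sym := @stack_connect_sym _ C R.

Let conn_lower x : stack_connect C R (lower x) (lower (g x)).
Proof. by apply: stack_lower; rewrite -arcE; apply: mate_same pR. Qed.

Let conn_vert x : x != c -> x != c1 -> stack_connect C R (outer x) (lower x).
Proof.
case: x => k kc kc1; last exact: connect0.
apply: (@stack_upper _ _ _ (inl k) (inr k)); rewrite same_cup_capE eqxx !inE.
exact/norP.
Qed.

(** The path runs straight down from [q], along a new arc to [c1], through the bottom arc of the
    generator to [c], and along the other new arc to [p]. This restores the arc {p, q}. *)
Let conn_qp : stack_connect C R (outer q) (lower p).
Proof.
apply: connect_trans (conn_vert qc qc1) _; apply: connect_trans (conn_lower q) _.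
rewrite gq; apply: (@connect_trans _ _ (lower c)); last by rewrite -gc; apply: conn_lower.
by apply: (@stack_upper _ C R (inr i) (inr _)); rewrite same_cup_capE !inE !eqxx !orbT.
Qed.

Let conn_f x : stack_connect C R (outer x) (outer (f x)).
Proof.
have cup : stack_connect C R (outer c) (outer c1).
  by apply: (@stack_upper _ C R (inl _) (inl _)); rewrite same_cup_capE !inE !eqxx !orbT.
have qp : stack_connect C R (outer q) (outer p).
  by apply: connect_trans conn_qp _; rewrite -/(stack_connect _ _ _ _) conn_sym conn_vert.
case: (class x) => [[|]->|[[|]->|ox]].
- by rewrite fc.
- by rewrite fp conn_sym.
- by rewrite fc1 conn_sym.
- exact: qp.
have /and4P[xc xc1 _ _] := ox; have /and4P[fxc fxc1 _ _] := other_f ox.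
apply: connect_trans (conn_vert xc xc1) _; rewrite -(go ox).
apply: connect_trans (conn_lower x) _; rewrite (go ox).
by rewrite -/(stack_connect _ _ _ _) conn_sym conn_vert.
Qed.

(** The blobs of [D] read on the whole stack. The middle points below the cup lie in the component
    of [q], so they take its value. Being constant on components, [beta] shows that the product
    gains no blob. *)
Let beta (z : 'I_n + 'I_n + 'I_n) := match z with
  | inl (inr k) => if (inl k == c) || (inl k == c1) then b q else b (inl k)
  | inl (inl k) => b (inl k)
  | inr k => b (inr k) end.

Let beta_lower x : beta (lower x) = if (x == c) || (x == c1) then b q else b x.
Proof. by case: x. Qed.

Let beta_conn u v : stack_connect C R u v -> beta u = beta v.
Proof.
have bc : b c = b c1 by rewrite -fc bf.
move: v; apply: connect_ind => // v w -> /stack_edgeP[] [x [y [-> -> s]]].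
  move: s; rewrite same_cup_capE; case: x y => x [] y; rewrite ?inE /=.
  - case/orP=> [/eqP->//|/andP[]].
    by case/orP=> /eqP->; case/orP=> /eqP->; rewrite ?bc.
  - case/andP=> /eqP<-; rewrite /c /c1; case/norP=> /negPf h /negPf h'.
    by rewrite [_ == inl _]h [_ == inl _]h'.
  - case/andP=> /eqP<-; rewrite /c /c1; case/norP=> /negPf h /negPf h'.
    by rewrite [_ == inl _]h [_ == inl _]h'.
  - case/orP=> [/eqP->//|/andP[]].
    by case/orP=> /eqP->; case/orP=> /eqP->; rewrite !eqxx ?orbT.
move: s; rewrite mateP // arcE => /orP[]/eqP->//; rewrite !beta_lower.
case: (class x) => [[|]->|[[|]->|ox]]; rewrite ?gc ?gp ?gc1 ?gq ?eqxx ?orbT.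
- by rewrite (negPf pc) (negPf pc1) bf.
- by rewrite (negPf pc) (negPf pc1) bf.
- by rewrite (negPf qc) (negPf qc1).
- by rewrite (negPf qc) (negPf qc1).
have /and4P[xc xc1 _ _] := ox; have /and4P[fxc fxc1 _ _] := other_f ox.
by rewrite (go ox) (negPf xc) (negPf xc1) (negPf fxc) (negPf fxc1) bf.
Qed.

Let tp : t p = p. Proof. by rewrite tpermD // eq_sym. Qed.

(** Both sides are pairings, so it suffices that [x] and [f x] are connected in the stack. For the
    blobs, [beta] gives one inclusion and an explicit blobbed middle or bottom point the other. *)
Lemma gen_reduced : bl_mul (bl_gen i) reduced = D.
Proof.
apply: Bl_ext => [|x].
  apply: mate_inj => [||x]; try exact: pairing_arcs.
  have: same (arcs (bl_mul (bl_gen i) reduced)) x (f x).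
    by rewrite [arcs _]/= same_mul arcs_gen; apply: conn_f.
  rewrite mateP; last exact: pairing_arcs.
  by rewrite (negPf (f_free x)) => /eqP.
rewrite blobbed_mul (eq_mark_mul _ _ blobbed_gen blobE) arcs_gen.
apply/existsP/idP => [[z /andP[xz /stack_markP[][y // by_ ez]]]|bx].
  have := beta_conn xz; have -> : beta (outer x) = b x by case: (x).
  rewrite -/b => ->; rewrite ez beta_lower; move: by_; rewrite /surgery_blob.
  case: (class y) => [[|]->|[[|]->|oy]]; rewrite ?eqxx ?orbT.
  - by rewrite tpermL.
  - by rewrite tp (negPf pc) (negPf pc1).
  - by rewrite [t c1]tpermD // (negPf nb).
  - by rewrite tpermR -bf fc (negPf nb).
  by have /and4P[/negPf-> /negPf-> _ _] := oy; rewrite tE.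
suff [y cy by_] : exists2 y, stack_connect C R (outer x) (lower y) & b (t y).
  by exists (lower y); rewrite [X in X && _]cy; apply/stack_markP; right; exists y.
case: (class x) bx => [[|]->|[[|]->|ox]] bx.
- by move: bx; rewrite -[blobbed D c]/(b c) -bf fc (negPf nb).
- by exists p; [apply: conn_vert|rewrite tp].
- by rewrite -[blobbed D c1]/(b c1) (negPf nb) in bx.
- by exists p; [apply: conn_qp|rewrite tp bf].
by have /and4P[xc xc1 _ _] := ox; exists x; [apply: conn_vert|rewrite tE].
Qed.

Let sum_four (w : pt n -> nat) :
  \sum_x w x = w c + (w p + (w c1 + (w q + \sum_(x | other x) w x))).
Proof.
rewrite (bigD1 c) //= (bigD1 p) //= (bigD1 c1) /= ?(eq_sym c1) ?cc1 ?(eq_sym _ p) ?pc1 //=.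
rewrite (bigD1 q) /= ?qc ?qc1 1?(eq_sym q) ?pq //.
congr (_ + (_ + (_ + (_ + _)))); apply: eq_bigl => x; rewrite /other -!andbA.
by congr andb; rewrite andbCA.
Qed.

(** Only the two exchanged arcs matter. If {p, q} is unblobbed, [p] lies on the left of the line and
    the step from [c] to [c1] is saved in both arcs. If it is blobbed, the blob moves to {c, p}.
    Either way two crossings are lost. *)
Lemma width_reduced : width reduced < width D.
Proof.
rewrite /width !sum_four.
have -> : \sum_(x | other x) weight reduced x = \sum_(x | other x) weight D x.
  apply: eq_bigr => x ox; rewrite /weight arcE blobE (go ox) /surgery_blob.
  by rewrite (tE ox).
rewrite /weight !arcE !blobE gc gp gc1 gq -/f -/b fc fc1 fp -/p /surgery_blob.
have bc : b c = false by rewrite -bf fc (negPf nb).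
rewrite tp tpermL tpermR [t c1]tpermD // bc (negPf nb) bf.
have [_ _] := and3P rq; rewrite -/p -/b.
have ic : (idx c).+1 = idx c1 := ord_predS.
move: iq ic; rewrite -[X in X <= _]/(idx c1) -[X in _ < X]/(idx c1).
by move: (idx c) (idx c1) (idx p) (idx q) (b q); clear => j k x y [] /=; lia.
Qed.

End Surgery.

(** * Factoring out the blob on the arc of 1 *)

Section Unblob.
Variables (n : nat) (D : Bl n) (k : 'I_n).
Let f := mate (arcs D).
Let x0 : pt n := inl k.
Hypotheses (k0 : k = 0 :> nat) (bk : blobbed D x0).

Let pD := pairing_arcs D.
Let fK : involutive f. Proof. exact: mateK. Qed.

Definition blob_rest (x : pt n) := [&& blobbed D x, x != x0 & x != f x0].

Let rest_exposed x : blob_rest x -> exposed f x.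
Proof. by case/and3P=> /exposed_mate. Qed.

Let rest_mate x : blob_rest (f x) = blob_rest x.
Proof.
rewrite /blob_rest blobbed_mate (can_eq fK) -[X in f x != X](fK x0) (can_eq fK).
by congr (_ && _); rewrite andbC.
Qed.

Definition unblob : Bl n :=
  diagram fK (fun x => mate_neq x pD) (@planar_mate n D) rest_exposed.

Let arcsE : arcs unblob = arcs D.
Proof. by apply: mate_inj => [||x]; try exact: pairing_arcs; rewrite mate_diagram. Qed.

Let blobE : blobbed unblob =1 blob_rest.
Proof. exact/blobbed_diagram/rest_mate. Qed.

Lemma gen_unblob : bl_mul (bl_gen k) unblob = D.
Proof.
have aG : arcs (bl_gen k) = setpart_one 'I_n by rewrite /arcs /= /bl_gen_val k0.
have bG : blobbed (bl_gen k) =1 pred2 x0 (inr k).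
  by move=> x; rewrite /blobbed /blobs /= /bl_gen_val k0 /= /cover big_set1 !inE.
apply: Bl_ext => [|x]; first by rewrite -arcsE -[RHS]setpart_mul1 -aG.
rewrite blobbed_mul (eq_mark_mul _ _ bG blobE) aG arcsE.
apply/existsP/idP => [[z /andP[xz mz]]|bx].
  case/stack_markP: mz xz => [] [y my ->] /stack_one_cl xy.
    suff /blobbed_same-> : same (arcs D) x x0 by [].
    by case/pred2P: my xy => ->; case: (x).
  have /and3P[by_ _ _] := my; suff /blobbed_same-> : same (arcs D) x y by [].
  by case: (x) (y) xy => ? [].
have [rx|] := boolP (blob_rest x).
  exists (lower x); rewrite [X in X && _]stack_one_lower.
  by apply/stack_markP; right; exists x.
rewrite /blob_rest bx -negb_or negbK => xx0.
exists (lower x0); rewrite [X in X && _](_ : is_true _); last first.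
  apply: connect_trans (stack_one_lower _ x) _; apply: stack_lower.
  by rewrite same_sym mateP.
by apply/stack_markP; left; exists (inr k); rewrite //= eqxx orbT.
Qed.

(** The arcs stay the same, and the horizontal distance between the ends of the arc of [x0] is less
    than the sum of their distances to the left side. *)
Lemma width_unblob : width unblob < width D.
Proof.
have wE x : weight unblob x = if blob_rest x then (idx x).+1 + (idx (f x)).+1
  else (idx x - idx (f x)) + (idx (f x) - idx x).
  by rewrite /weight arcsE blobE.
rewrite [width unblob](bigD1 x0) // [width D](bigD1 x0) //= -addSn leq_add //.
  by rewrite wE /weight bk /blob_rest eqxx andbF -/f; lia.
apply: leq_sum => x _; rewrite wE /weight -/f /blob_rest.
by case: (blobbed D x) => //=; case: ifP => _; lia.
Qed.

End Unblob.

(** * The generators generate all blobbed diagrams *)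

Lemma homo_ltn_ord n (h : 'I_n -> 'I_n) :
  {homo h : x y / (x < y)%N} -> h =1 id.
Proof.
move=> hh; have ge m (ltm : m < n) : m <= h (Ordinal ltm).
  elim: m ltm => // m IHm ltm.
  by apply: leq_ltn_trans (IHm (ltnW ltm)) (hh _ _ _) => /=.
(* The upper bound is the lower bound for [h] conjugated by the reversal of the order. *)
have le m (ltm : m < n) : m <= rev_ord (h (rev_ord (Ordinal ltm))).
  elim: m ltm => // m IHm ltm; apply: leq_ltn_trans (IHm (ltnW ltm)) _.
  have := hh (rev_ord (Ordinal ltm)) (rev_ord (Ordinal (ltnW ltm))).
  by have := ltn_ord (h (rev_ord (Ordinal (ltnW ltm)))); rewrite /=; lia.
case=> k ltk; apply: val_inj => /=; have := ge k ltk.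
have ltr : n - k.+1 < n by lia.
have e : rev_ord (Ordinal ltr) = Ordinal ltk by apply: val_inj => /=; lia.
by have := le _ ltr; rewrite e /=; have := ltn_ord (h (Ordinal ltk)); lia.
Qed.

Section Generation.
Variable n : nat.
Implicit Type D : Bl n.

Lemma diagram_one D :
  (forall k : 'I_n, k <= rk (mate (arcs D) (inl k))) ->
  (forall k : 'I_n, k = 0 :> nat -> ~~ blobbed D (inl k)) -> D = bl_one n.
Proof.
set f := mate _ => up nb.
have pD := pairing_arcs D; have fK : involutive f := mateK pD.
have pf : planar f := @planar_mate n D.
(* The default [k] is never taken: without cups every top point is joined to the bottom row. *)
pose h k := if f (inl k) is inr m then m else k.
have fh k : f (inl k) = inr (h k).
  rewrite /h; case e : (f (inl k)) => [m|//].
  have := up k; have := up m; rewrite -/f -e fK e /= => mk km.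
  have := mate_neq (inl k) pD; rewrite -/f e.
  by have -> : m = k; [apply: val_inj; apply/eqP; rewrite eqn_leq mk | rewrite eqxx].
have h_id : h =1 id.
  apply: homo_ltn_ord => x y xy.
  have nyx : inl y != inl x :> pt n by apply: contraTneq xy => -[->]; rewrite ltnn.
  have hxy : h x != h y.
    by apply: contraNneq nyx => e; have := fh y; rewrite -e -fh => /(can_inj fK)->.
  have := pf _ _ nyx; rewrite !fh => /(_ isT); rewrite /betw /=.
  have := ltn_ord x; have := ltn_ord y; have := ltn_ord (h x); have := ltn_ord (h y).
  move: hxy; rewrite -val_eqE /=; move: (val (h x)) (val (h y)) xy => /=; clear.
  lia.
have fl k : f (inl k) = inr k by rewrite fh h_id.
have fr k : f (inr k) = inl k by rewrite -fl fK.
apply: Bl_ext.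
  apply: setpart_ext => x y; rewrite mateP // -/f [RHS]same_oneE.
  have i1 (u v : 'I_n) : (inl u == inl v :> pt n) = (u == v) by [].
  have i2 (u v : 'I_n) : (inr u == inr v :> pt n) = (u == v) by [].
  by case: x y => x [] y; rewrite ?fl ?fr /= ?i1 ?i2 ?orbF // eq_sym.
(* The vertical arc of 1 encloses all the others, so it alone could carry a blob. *)
have nbl k : ~~ blobbed D (inl k).
  apply/negP => bk; have [k0|k0] := posnP k; first by rewrite (negPf (nb k k0)) in bk.
  have n0 : 0 < n by apply: leq_ltn_trans (ltn_ord k).
  have := exposed_mate bk (inl (Ordinal n0)); rewrite -/f !fl /=.
  by have := ltn_ord k; lia.
move=> x; rewrite blobbed_one; case: x => k; apply: negbTE => //.
by rewrite -blobbed_mate -/f fr.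
Qed.

Lemma Bl_gen_ind (G : Bl n -> Prop) :
  G (bl_one n) -> (forall i D, G D -> G (bl_mul (bl_gen i) D)) -> forall D, G D.
Proof.
move=> G1 GM D; have [m] := ubnP (width D); elim: m D => // m IHm D.
rewrite ltnS => wD; set f := mate (arcs D).
case: (pickP (fun k : 'I_n => (k == 0 :> nat) && blobbed D (inl k))) => [k|nb].
  case/andP=> /eqP k0 bk; rewrite -(gen_unblob k0 bk); apply: GM; apply: IHm.
  exact: leq_trans (width_unblob k0 bk) wD.
have pD := pairing_arcs D; have fK : involutive f := mateK pD.
have pf : planar f := @planar_mate n D.
have f_free x : f x != x by exact: mate_neq.
have [] := boolP [exists k : 'I_n, rk (f (inl k)) < k]; last first.
  rewrite negb_exists => /forallP up; rewrite (_ : D = bl_one n) //.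
  apply: diagram_one => k; first by rewrite leqNgt.
  by move=> k0; have := nb k; rewrite k0 eqxx => /= ->.
case/existsP=> k0 dk0.
(* [i] is the first right end of a cup in the top row. *)
have [i di imin] := @arg_minnP _ k0 (fun k : 'I_n => rk (f (inl k)) < k) val dk0.
have {}imin (k : 'I_n) : k < i -> k <= rk (f (inl k)).
  by move=> ki; rewrite leqNgt; apply: contraL ki => /imin; rewrite -leqNgt.
have i0 : 0 < i by apply: leq_ltn_trans di.
have [j ej jS] : exists2 j, ord_pred i = j & j.+1 = i :> nat.
  by exists (ord_pred i); rewrite ?ord_predS.
(* If the left end [l] of the cup were before [j], then [f j] would be trapped between [l] and [i].
   By minimality of [i] it is after [j], which leaves only [i]. *)
have fj : f (inl j) = inl i.
  case e : (f (inl i)) => [l|l]; last by move: di; rewrite e /=; have := ltn_ord i; lia.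
  have [lj|lj] := eqVneq l j; first by rewrite -lj -e fK.
  have nx : inl j != inl l :> pt n by rewrite eq_sym.
  have fl : f (inl l) = inl i by rewrite -e fK.
  have nfx : inl j != f (inl l) by rewrite fl; apply/eqP => -[ji]; move: jS; rewrite ji; lia.
  have := pf _ _ nx nfx; rewrite fl /betw /=.
  have := rk_neq (f_free (inl j)); have := imin j; rewrite -jS ltnSn => /(_ isT).
  move: di lj; rewrite e -val_eqE /= => h1 h2 h3 h4 h5.
  by apply: rk_inj => /=; lia.
(* If [j] is the point 1, a blob was excluded above. Otherwise the point [l] before [j] is joined
   past [i], by minimality, and its arc hides the cup from the left side. *)
have nbi : ~~ blobbed D (inl i).
  apply/negP => bi; have [j0|j0] := posnP j.
    by have := nb j; rewrite j0 eqxx -blobbed_mate -/f fj bi.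
  have [l lS] : exists l : 'I_n, l.+1 = j :> nat by exists (ord_pred j); rewrite ord_predS.
  have fi : f (inl i) = inl j by rewrite -fj fK.
  have li : l < i by rewrite -jS -lS; apply: ltnW.
  have := exposed_mate bi (inl l); rewrite -/f fi.
  have := imin l li; have := rk_neq (f_free (inl l)).
  have l1 : rk (f (inl l)) != rk (inl j).
    apply: rk_neq; apply/eqP => /(congr1 f); rewrite fK fj => -[li'].
    by move: jS lS; rewrite li'; lia.
  have l2 : rk (f (inl l)) != rk (inl i).
    apply: rk_neq; apply/eqP => /(congr1 f); rewrite fK fi => -[lj].
    by move: lS; rewrite lj; lia.
  move: l1 l2 => /=; lia.
rewrite -ej in fj; have [q rq qmin] := reach_exists i0 fj.
rewrite -(gen_reduced i0 fj nbi rq qmin); apply: GM; apply: IHm.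
exact: leq_trans (width_reduced i0 fj nbi rq qmin) wD.
Qed.

End Generation.

(** * The hook partition of a blobbed diagram: multiplicativity and injectivity *)

Section HookPart.
Variable n : nat.
Implicit Types (D E : Bl n) (p q : pt n).
Let X := 'I_n.
Let X' := 'I_n.+1.

Definition hook_pt p : X' + X' :=
  match p with inl k => inl (lift ord0 k) | inr k => inr (lift ord0 k) end.

Definition pt_of (x : X' + X') : option (pt n) :=
  match x with
  | inl u => omap inl (unlift ord0 u)
  | inr u => omap inr (unlift ord0 u) end.

Lemma hook_ptK p : pt_of (hook_pt p) = Some p.
Proof. by case: p => k /=; rewrite liftK. Qed.

Variant hook_pt_spec : X' + X' -> option (pt n) -> Type :=
  | HookPt p : hook_pt_spec (hook_pt p) (Some p)
  | HookTop : hook_pt_spec (inl ord0) None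
  | HookBottom : hook_pt_spec (inr ord0) None.

Lemma hook_ptP x : hook_pt_spec x (pt_of x).
Proof.
case: x => u /=; case: unliftP => [k|] -> /=; try by constructor.
  exact: (HookPt (inl k)).
exact: (HookPt (inr k)).
Qed.

(** The key [None] marks the block of 0 and 0', which absorbs all blobbed arcs. *)
Definition hook_key D (x : X' + X') : option {set pt n} :=
  if pt_of x is Some p then
    if blobbed D p then None else Some (pblock (arcs D) p)
  else None.

Definition hook_part D : partition_monoid 'I_n.+1 := keypart (hook_key D).

Lemma same_hook D x y : same (hook_part D) x y =
  match pt_of x, pt_of y with
  | Some p, Some q => blobbed D p && blobbed D q || same (arcs D) p q
  | Some p, None => blobbed D p
  | None, Some q => blobbed D q
  | None, None => true
  end.
Proof.
rewrite same_keypart /hook_key.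
case: (pt_of x) (pt_of y) => [p|] [q|] //; last 2 first.
- by case: (blobbed D p).
- by case: (blobbed D q).
have pqE : (pblock (arcs D) p == pblock (arcs D) q) = same (arcs D) p q.
  by rewrite eq_pblock ?setpart_triv ?setpart_cover.
have := @blobbed_same _ D p q; rewrite -pqE.
case: (blobbed D p) (blobbed D q) => [] [] //= h; last by case: eqP h => // _ /(_ isT).
by case: eqP h => // _ /(_ isT).
Qed.

Section Mul.
Variables D E : Bl n.
Let P := arcs D.
Let Q := arcs E.
Let P' := hook_part D.
Let Q' := hook_part E.

Let hz (z : X + X + X) : X' + X' + X' := match z with
  | inl p => inl (hook_pt p) | inr k => inr (lift ord0 k) end.

Let hz_lower p : hz (lower p) = lower (hook_pt p). Proof. by case: p. Qed.
Let hz_outer p : hz (outer p) = outer (hook_pt p). Proof. by case: p. Qed.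

Let zu (z : X' + X' + X') : option (X + X + X) := match z with
  | inl x => omap inl (pt_of x) | inr u => omap inr (unlift ord0 u) end.

Let zu_lower x : zu (lower x) = omap (@lower X) (pt_of x).
Proof. by case: x => u /=; case: unliftP. Qed.
Let zu_outer x : zu (outer x) = omap (@outer X) (pt_of x).
Proof. by case: x => u /=; case: unliftP. Qed.

Let marked z := [exists w, stack_connect P Q z w && stack_mark (blobbed D) (blobbed E) w].

Let marked_connect u v : stack_connect P Q u v -> marked u = marked v.
Proof.
move=> uv; apply: eq_existsb => w; congr (_ && _).
exact/same_connect/uv/stack_connect_sym.
Qed.

(** An invariant of the components of the hook stack. It is [None] on the three points 0 and on the
    components that meet a blob, and elsewhere it is the component in the stack of arcs. *)
Let key z : option {set X + X + X} :=
  if zu z is Some w then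
    if marked w then None else Some [set v | stack_connect P Q w v]
  else None.

Let set_connect u v : stack_connect P Q u v ->
  [set w | stack_connect P Q u w] = [set w | stack_connect P Q v w].
Proof.
move=> uv; apply/setP => w; rewrite !inE.
exact/same_connect/uv/stack_connect_sym.
Qed.

Let mark_upper p : blobbed D p -> marked (upper p).
Proof.
move=> bp; apply/existsP; exists (upper p); rewrite [X in X && _]connect0.
by apply/stack_markP; left; exists p.
Qed.

Let mark_lower p : blobbed E p -> marked (lower p).
Proof.
move=> bp; apply/existsP; exists (lower p); rewrite [X in X && _]connect0.
by apply/stack_markP; right; exists p.
Qed.

Let key_connect u v : stack_connect P' Q' u v -> key u = key v.
Proof.
move: v; apply: connect_ind => // v w -> /stack_edgeP[] [x [y [-> -> ]]];
  rewrite same_hook /key ?zu_lower /=.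
- case: (pt_of x) (pt_of y) => [p|] [q|] //=; try by move/mark_upper=> ->.
  case/orP=> [/andP[/mark_upper-> /mark_upper->]//|/(@stack_upper _ P Q) pq].
  by rewrite (marked_connect pq) (set_connect pq).
- case: (pt_of x) (pt_of y) => [p|] [q|] //=; try by move/mark_lower=> ->.
  case/orP=> [/andP[/mark_lower-> /mark_lower->]//|/(@stack_lower _ P Q) pq].
  by rewrite (marked_connect pq) (set_connect pq).
Qed.

Let hz_connect u v : stack_connect P Q u v -> stack_connect P' Q' (hz u) (hz v).
Proof.
move: v; apply: connect_ind => [|v w uv e]; first exact: connect0.
apply: connect_trans uv _; case/stack_edgeP: e => [] [p [q [-> -> s]]].
  by apply: (@stack_upper _ P' Q'); rewrite same_hook !hook_ptK s orbT.
by rewrite !hz_lower; apply: (@stack_lower _ P' Q'); rewrite same_hook !hook_ptK s orbT.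
Qed.

Let zero : X' + X' + X' := inl (inl ord0).

Let pt_of0l : pt_of (inl ord0) = None. Proof. by rewrite /= unlift_none. Qed.
Let pt_of0r : pt_of (inr ord0) = None. Proof. by rewrite /= unlift_none. Qed.

Let zero_upper x : same P' x (inl ord0) -> stack_connect P' Q' (upper x) zero.
Proof. exact: (@stack_upper _ P' Q' x (inl ord0)). Qed.

Let zero_lower x : same Q' x (inl ord0) -> stack_connect P' Q' (lower x) zero.
Proof.
move=> s; apply: connect_trans (stack_lower _ s) _.
by apply: (@zero_upper (inr ord0)); rewrite same_hook pt_of0l pt_of0r.
Qed.

(** A blobbed piece lies in the block of 0 of its own factor, and these blocks meet at the middle
    point 0. *)
Let marked_zero z : marked z -> stack_connect P' Q' (hz z) zero.
Proof.
case/existsP=> w /andP[/hz_connect zw mw]; apply: connect_trans zw _.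
case/stack_markP: mw => [] [p bp ->].
  by apply: (@zero_upper (hook_pt p)); rewrite same_hook hook_ptK pt_of0l.
by rewrite hz_lower; apply: zero_lower; rewrite same_hook hook_ptK pt_of0l.
Qed.

Let zero_outer x : hook_key (bl_mul D E) x = None ->
  stack_connect P' Q' (outer x) zero.
Proof.
rewrite /hook_key; case: hook_ptP => [p| |]; last 2 first.
- by move=> _; apply: connect0.
- by move=> _; apply: (@zero_lower (inr ord0)); rewrite same_hook pt_of0l pt_of0r.
by rewrite blobbed_mul -hz_outer; case: ifP => // m _; apply: marked_zero.
Qed.

(** Points with equal hook keys are either both connected to [zero] or connected in the stack of
    arcs, which [hz] embeds. Conversely, [key] is constant on connected points and recovers the hook
    keys. *)
Lemma hook_part_mul : hook_part (bl_mul D E) = setpart_mul P' Q'.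
Proof.
apply: setpart_ext => x y; rewrite same_mul; apply/idP/idP.
  rewrite same_keypart => /eqP e.
  have [kx|kx] := eqVneq (hook_key (bl_mul D E) x) None.
    apply: connect_trans (zero_outer kx) _.
    by rewrite -/(stack_connect _ _ _ _) stack_connect_sym zero_outer -?e.
  have : same (hook_part (bl_mul D E)) x y by rewrite same_keypart e.
  rewrite same_hook; have ky := kx; rewrite e in ky; move: kx ky; rewrite /hook_key.
  case: (hook_ptP x) => // p; case: (hook_ptP y) => // q.
  case: (blobbed _ p) => //= _ _; rewrite [same _ p q]same_mul.
  by move/hz_connect; rewrite !hz_outer.
move/key_connect; rewrite /key !zu_outer same_hook.
have mE p : blobbed (bl_mul D E) p = marked (outer p) by rewrite blobbed_mul.
case: (pt_of x) (pt_of y) => [p|] [q|] //=; rewrite !mE; last 2 first.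
- by case: (marked (outer p)).
- by case: (marked (outer q)).
case: (marked (outer p)) (marked (outer q)) => [] [] //= [] /setP/(_ (outer q)).
by rewrite !inE [X in _ = X]connect0 [same _ p q]same_mul.
Qed.

End Mul.

Lemma hook_part_one : hook_part (bl_one n) = setpart_one X'.
Proof.
apply: setpart_ext => x y; rewrite same_hook [RHS]same_oneE.
have l0 k : (lift ord0 k == ord0 :> X') = false by rewrite eq_sym; apply/negbTE/neq_lift.
have l0' k : (ord0 == lift ord0 k :> X') = false by apply/negbTE/neq_lift.
have li k m : (lift ord0 k == lift ord0 m :> X') = (k == m).
  by rewrite (inj_eq lift_inj).
case: hook_ptP => [p| |]; case: hook_ptP => [q| |];
  rewrite ?blobbed_one ?[same _ p q]same_oneE //=.
all: do ?case: p => ? /=; do ?case: q => ? /=; rewrite ?li ?l0 ?l0' ?eqxx //.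
Qed.

(** The block of 0 shows which points are blobbed, and the other blocks are the unblobbed arcs. It
    remains to recover the pairing of the blobbed points. *)
Lemma hook_part_inj : injective hook_part.
Proof.
move=> D E eDE; have e x y : same (hook_part D) x y = same (hook_part E) x y by rewrite eDE.
have eb p : blobbed D p = blobbed E p.
  by have := e (inl ord0) (hook_pt p); rewrite !same_hook hook_ptK /= unlift_none.
apply: diagram_ext => // p; have pD := pairing_arcs D; have pE := pairing_arcs E.
set f := mate (arcs D); set g := mate (arcs E).
have fK : involutive f := mateK pD; have gK : involutive g := mateK pE.
have [bp|bp] := boolP (blobbed D p); last first.
  have := e (hook_pt p) (hook_pt (f p)); rewrite !same_hook !hook_ptK -!eb.
  rewrite (negPf bp) /= mate_same // mateP // (negPf (mate_neq _ pD)).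
  by move/esym/eqP.
(* The blobbed arcs are neither nested nor crossing, so each pairs two
   consecutive blobbed points. *)
have next (F : Bl n) u v : blobbed F u -> blobbed F v -> rk u < rk v ->
    rk v < rk (mate (arcs F) u) -> False.
  move=> bu bv uv vm; have := exposed_mate bv u.
  have vu : v != u by apply: contraTneq uv => ->; rewrite ltnn.
  have vfu : v != mate (arcs F) u by apply: contraTneq vm => ->; rewrite ltnn.
  have := planar_mate vu vfu; rewrite /betw.
  have nfu : mate (arcs F) v != mate (arcs F) u by rewrite (can_eq (mateK (pairing_arcs F))).
  have := rk_neq nfu; move: uv vm.
  move: (rk u) (rk v) (rk (mate _ u)) (rk (mate _ v)); clear; lia.
(* If one of the two candidate mates precedes [p], the induction hypothesis applies to it. If both
   follow [p], the nearer one would be a blobbed point inside the other arc, against [next]. *)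
have [m] := ubnP (rk p); elim: m p bp => // m IHm p bp; rewrite ltnS => pm.
have bfp : blobbed D (f p) by rewrite blobbed_mate.
have bgp : blobbed D (g p) by rewrite eb blobbed_mate -eb.
have [fp|pf] := ltnP (rk (f p)) (rk p).
  have e1 : p = g (f p) by rewrite -(IHm _ bfp (leq_trans fp pm)) fK.
  by rewrite [in RHS]e1 gK.
have [gp|pg] := ltnP (rk (g p)) (rk p).
  have e1 : f (g p) = p by rewrite (IHm _ bgp (leq_trans gp pm)) gK.
  by rewrite -[in LHS]e1 fK.
have lpf : rk p < rk (f p) by rewrite ltn_neqAle pf rk_neq // eq_sym mate_neq.
have lpg : rk p < rk (g p) by rewrite ltn_neqAle pg rk_neq // eq_sym mate_neq.
case: (ltngtP (rk (f p)) (rk (g p))) => [lt|lt|/rk_inj//].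
- by case: (next E p (f p)); rewrite -?eb.
- by case: (next D p (g p)).
Qed.

End HookPart.

(** * The isomorphism onto the hook blob monoid *)

Definition column (X : Type) (x : X + X) : X :=
  match x with inl u => u | inr u => u end.

Lemma same_join_part (X : finType) (a b : X) x y :
  same (join_part a b) x y = (column x == column y)
    || ((column x \in [:: a; b]) && (column y \in [:: a; b])).
Proof.
set u := column x; set v := column y; have [uab|uab] := boolP (u \in [:: a; b]).
  have BP : [set inl a; inl b; inr a; inr b] \in join_part a b by exact: setU11.
  rewrite -(same_block y BP); last first.
    by move: uab; rewrite /u !inE; case: (x) => z /orP[]/eqP/=->; rewrite eqxx ?orbT.
  have -> : (u == v) || true && (v \in [:: a; b]) = (v \in [:: a; b]).
    by case: eqP => // <-.
  by rewrite /v !inE; case: (y) => z; rewrite ?orbF.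
have BP : [set inl u; inr u] \in join_part a b.
  apply/setU1P; right; apply/imsetP; exists u => //.
  by move: uab; rewrite !inE negb_or.
rewrite -(same_block y BP); last by rewrite /u !inE; case: (x) => z; rewrite eqxx ?orbT.
by rewrite orbF /v !inE; case: (y) => z; rewrite ?orbF [RHS]eq_sym.
Qed.

Lemma same_cup_cap_ord m (a b : 'I_m) x y :
  same (cup_cap a b) x y =
  let u := idx x in let v := idx y in
  let ends (w : nat) := (w == a) || (w == b) in
  match x, y with
  | inl _, inl _ | inr _, inr _ => (u == v) || (ends u && ends v)
  | _, _ => (u == v) && ~~ ends u
  end.
Proof. by rewrite same_cup_capE; case: x y => x [] y; rewrite !inE. Qed.

Section Iso.
Variable n : nat.

Lemma hook_part_gen i : hook_part (bl_gen i) = @hook_gen n i.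
Proof.
apply: setpart_ext => x y; rewrite same_hook /hook_gen.
have [i0|i0] := eqVneq (i : nat) 0.
- have -> : arcs (bl_gen i) = setpart_one 'I_n by rewrite /arcs /= /bl_gen_val i0.
  have bE p : blobbed (bl_gen i) p = (p == inl i) || (p == inr i).
    by rewrite /blobbed /blobs /= /bl_gen_val i0 /= /cover big_set1 !inE.
  rewrite same_join_part.
  have i1 (u v : 'I_n) : (inl u == inl v :> pt n) = (u == v) by [].
  have i2 (u v : 'I_n) : (inr u == inr v :> pt n) = (u == v) by [].
  have i3 (u v : 'I_n) : (inl u == inr v :> pt n) = false by [].
  case: hook_ptP => [[p|p]| |]; case: hook_ptP => [[q|q]| |];
    rewrite ?bE ?same_oneE ?i1 ?i2 ?i3 !inE /= -?val_eqE /= /bump /= ?add1n ?eqSS ?i0 //; lia.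
- have -> : arcs (bl_gen i) = cup_cap (ord_pred i) i.
  by rewrite /arcs /= /bl_gen_val (negPf i0).
have bE p : blobbed (bl_gen i) p = false.
  by rewrite /blobbed /blobs /= /bl_gen_val (negPf i0) /= /cover big_set0 inE.
have jS := ord_predS (i := i); rewrite lt0n in jS; move: (ord_pred i) (jS i0) => j {}jS.
case: hook_ptP => [[p|p]| |]; case: hook_ptP => [[q|q]| |];
  rewrite ?bE ?same_cup_cap_ord /= /bump /= ?add1n -?jS ?eqSS //; lia.
Qed.

Lemma hook_part_mem D : hook_part D \in hook_set n.
Proof.
elim/Bl_gen_ind: D => [|i D IH]; apply/bigcapP => S /andP[SM SG].
  by rewrite hook_part_one; case/andP: SM.
rewrite hook_part_mul; have /andP[_ /forall_inP SM'] := SM.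
have GS : hook_part (bl_gen i) \in S by rewrite hook_part_gen (forallP SG).
have /forall_inP h := SM' _ GS; apply: h.
by move/bigcapP: IH; apply; rewrite SM.
Qed.

Definition blob_hook D : hook n := Hook (hook_part_mem D).

Lemma blob_hookM : {morph blob_hook : D E / (D * E)%g >-> (D * E)%g}.
Proof. by move=> D E; apply: val_inj; rewrite /= hook_part_mul. Qed.

Lemma blob_hook1 : blob_hook 1%g = 1%g.
Proof. by apply: val_inj; rewrite /= hook_part_one. Qed.

HB.instance Definition _ :=
  isMultiplicative.Build (Bl n) (hook n) blob_hook blob_hookM.
HB.instance Definition _ :=
  Multiplicative_isUMagmaMorphism.Build (Bl n) (hook n) blob_hook blob_hook1.

Lemma blob_hook_inj : injective blob_hook.
Proof. by move=> D E /(congr1 (@hook_val n)) /hook_part_inj. Qed.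

(** The image is a submonoid containing the generators, hence one of the sets intersected in
    [hook_set]. *)
Lemma blob_hook_surj h : exists D, blob_hook D = h.
Proof.
pose S : {set partition_monoid 'I_n.+1} := [set hook_part D | D : Bl n].
suff /imsetP[D _ hD] : hook_val h \in S by exists D; apply: val_inj.
have /bigcapP := valP h; apply; apply/andP; split; last first.
  by apply/forallP => i; rewrite -hook_part_gen imset_f.
apply/andP; split; first by rewrite -[1%g]hook_part_one imset_f.
apply/forall_inP => _ /imsetP[D _ ->]; apply/forall_inP => _ /imsetP[E _ ->].
by rewrite -[(_ * _)%g]hook_part_mul imset_f.
Qed.

Lemma blob_hook_bij : bijective blob_hook.
Proof.
apply: inj_card_bij blob_hook_inj _; rewrite -(card_codom blob_hook_inj).
by apply/subset_leq_card/subsetP => h _; have [D <-] := blob_hook_surj h; apply: codom_f.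
Qed.

End Iso.

Theorem theorem2p15 (n : nat) (hn : (1 <= n)%N) :
  exists phi : UMagmaMorphism.type (Bl n) (hook n),
    bijective phi /\
    (forall i : 'I_n, hook_val (phi (bl_gen i)) = hook_gen i).
Proof.
by exists (@blob_hook n); split=> [|i]; [apply: blob_hook_bij | apply: hook_part_gen].
Qed.
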